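(* Let $N\ge 3$, for $\gamma\in(0,\pi)$ let $\lambda_1(\gamma)$ be the first Dirichlet eigenvalue of $-\Delta_{S^{N-1}}$ on the spherical cap $\mathcal{D}_\gamma$, and let $B_1$ be the first positive zero of the Bessel function $J_{\frac{N-3}{2}}$. Then $$\lim_{\gamma\to0}\frac{\lambda_1(\gamma)\,\gamma^2}{B_1^2}=1 .$$
   Context: For $0<\gamma<\pi$, $\mathcal{C}_\gamma=\{x\in\mathbb{R}^N\setminus\{0\} : x_N>|x|\cos\gamma\}$ is the circular cone with vertex $0$, axis the positive $x_N$-axis and slot $\gamma$; $\mathcal{D}_\gamma=\mathcal{C}_\gamma\cap S^{N-1}$; and $\Delta_{S^{N-1}}$ is the Laplace–Beltrami operator on the unit sphere $S^{N-1}$. $J_\nu$ is the Bessel function of the first kind. *)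

(* Defs.v *)
From HB Require Import structures.
From mathcomp Require Import all_boot all_order all_algebra.
From mathcomp Require Import all_classical all_reals all_analysis.

Set Implicit Arguments.
Unset Strict Implicit.
Unset Printing Implicit Defensive.

Import Order.TTheory GRing.Theory Num.Theory.
Import numFieldNormedType.Exports.

Local Open Scope classical_set_scope.
Local Open Scope ring_scope.

Section Least.
Context {R : realType}.

(* Minimum of [A]; it is 0 when [A] has no minimum. *)
Definition least (A : set R) : R := xget 0 [set x | A x /\ lbound A x].

Definition first_positive_zero (f : R -> R) : R :=
  least [set x | 0 < x /\ f x = 0].

End Least.

Section Bessel.
Context {R : realType}.

(* Euler's integral, meaningful for [0 < s]. *)
Definition Gamma (s : R) : R :=
  Rintegral (@lebesgue_measure R) `]0, +oo[%classic
    (fun t => t `^ (s - 1) * expR (- t)).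

(* Meaningful for [0 < x] and [-1 < nu]. *)
Definition bessel_J (nu x : R) : R :=
  limn (series (fun k : nat =>
    (-1) ^+ k / (k`!%:R * Gamma (k%:R + nu + 1)) *
    (x / 2) `^ (k%:R *+ 2 + nu))).

End Bessel.

(* The ambient space R^N is ['rV[R]_n.+1], with N = n.+1, so that the last
   coordinate x_N is [x 0 ord_max]. *)
Section SphericalCap.
Context {R : realType} {n : nat}.
Implicit Types (x : 'rV[R]_n.+1) (f u : 'rV[R]_n.+1 -> R) (g lam : R).

(* The norm [`|x|] of the library on row vectors is the sup norm. *)
Definition enorm x : R := Num.sqrt (\sum_i x 0 i ^+ 2).

Definition sphere : set 'rV[R]_n.+1 := [set x | enorm x = 1].

Definition cone g : set 'rV[R]_n.+1 :=
  [set x | x != 0 /\ enorm x * cos g < x 0 ord_max].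

Definition cap g : set 'rV[R]_n.+1 := cone g `&` sphere.

Definition partial (i : 'I_n.+1) f : 'rV[R]_n.+1 -> R :=
  'D_(delta_mx 0 i) f.

Definition laplacian f x : R := \sum_i partial i (partial i f) x.

(* [A] is meant to be open. *)
Definition C2_on (A : set 'rV[R]_n.+1) f : Prop :=
  forall x, A x ->
  [/\ {for x, continuous f},
      forall i, derivable f x (delta_mx 0 i),
      forall i, {for x, continuous (partial i f)},
      forall i j, derivable (partial i f) x (delta_mx 0 j) &
      forall i j, {for x, continuous (partial j (partial i f))}].

(* A function on (a part of) the sphere is represented by any
   [u : 'rV[R]_n.+1 -> R] with these values on the sphere; [hom0ext u] is its
   extension to the punctured space that is constant along rays. *)
Definition hom0ext u : 'rV[R]_n.+1 -> R := fun x => u ((enorm x)^-1 *: x).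

(* The Laplace-Beltrami operator of the round unit sphere, for [x] on the
   sphere: the Euclidean Laplacian of the 0-homogeneous extension. *)
Definition laplace_beltrami u x : R := laplacian (hom0ext u) x.

(* [cap g] is relatively open in the sphere, so its boundary in the sphere is
   [closure (cap g) `\` cap g]; [u] is C^2 on [cap g] as a function on the
   sphere iff [hom0ext u] is C^2 on the open cone [cone g]. *)
Definition dirichlet_eigenfunction g lam u : Prop :=
  [/\ C2_on (cone g) (hom0ext u),
      {within closure (cap g), continuous u},
      forall x, (closure (cap g) `\` cap g) x -> u x = 0,
      forall x, cap g x -> - laplace_beltrami u x = lam * u x &
      exists x, cap g x /\ u x != 0].

Definition dirichlet_eigenvalue g lam : Prop :=
  exists u, dirichlet_eigenfunction g lam u.

End SphericalCap.

Definition first_dirichlet_eigenvalue {R : realType} (n : nat) (g : R) : R :=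
  least [set lam | @dirichlet_eigenvalue R n g lam].

(* Main.v *)
Require Import Defs.
From HB Require Import structures.
From mathcomp Require Import all_boot all_order all_algebra.
From mathcomp Require Import all_classical all_reals all_analysis.
From mathcomp Require Import measurable_realfun ring lra.

Set Implicit Arguments.
Unset Strict Implicit.
Unset Printing Implicit Defensive.

Import Order.TTheory GRing.Theory Num.Theory.
Import numFieldNormedType.Exports.

Local Open Scope classical_set_scope.
Local Open Scope ring_scope.

(** Write c = n / 2, where n is the dimension of the sphere.  On functions of
the height x_N alone, the eigenvalue equation on the sphere becomes, in the
variable t = (1 - x_N) / 2, the hypergeometric equation
  t (1 - t) y'' + (c - 2 c t) y' + l y = 0,
and the cap of slot g is the interval 0 <= t < t0 with t0 = (1 - cos g) / 2.
Its solution regular at t = 0 is the member [radial c 1 l] of the family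
[radial c a b] of regular solutions of
  t (1 - a t) y'' + (c - 2 a c t) y' + b y = 0.
The member [radial c 0 1] is the Bessel-Clifford function: up to a positive
factor, J_(c - 1) x is its value at x ^ 2 / 4 ([bessel_J_radial]).

The family is homogeneous: the value of [radial c a b] at t depends on a * t and
b * t only ([radial_scale]), and it is jointly continuous in these two numbers
as long as |a * t| < 1 ([radial_continuous], by dominated convergence of the
power series).  So rescaling t by 1 / l turns the equation on a small cap into a
small perturbation of the Bessel equation.

For each t0, let l be the least parameter for which [radial c 1 l] vanishes
somewhere on [0, t0].  The zero is then at t0 itself: an interior first zero
would be a crossing, because radial solutions have negative derivative up to
and at their first zero ([radial1_lt0]), and the solution would be negative just
after it, whereas it is a limit of positive functions
([radial_first_parameter]).  Hence [radial c 1 l] gives an eigenfunction on the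
cap, and for every l' < l it gives a zonal function with eigenvalue l' that is
positive on the closed cap.  The maximum principle applied to the quotient of an
arbitrary eigenfunction by the latter shows that no eigenvalue is smaller than
l' ([eigenvalue_ge]).  Therefore l is the first Dirichlet eigenvalue
([first_dirichlet_eigenvalue_zonal]).

Finally l * t0 is the least s for which [radial c t0 s] has a zero on [0, 1], and
as t0 tends to 0 it tends to the first zero s1 of the Bessel-Clifford function,
because that function is positive before s1 and takes negative values
arbitrarily close after it ([first_parameter_cvg]).  Since B1 ^ 2 = 4 * s1 and
t0 / g ^ 2 tends to 1 / 4, the theorem follows. *)

(** * Elementary differentiation rules *)

Section IsDerive.
Context {R : realType} {V : normedModType R}.
Implicit Types (f : V -> R) (x v : V) (k df : R).

Lemma is_derive_derivable f x v df : is_derive x v f df -> derivable f x v.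
Proof. by case. Qed.

Lemma is_derive_val f x v df : is_derive x v f df -> 'D_v f x = df.
Proof. by case. Qed.

Lemma is_deriveMl k f x v df :
  is_derive x v f df -> is_derive x v (fun y => k * f y) (k * df).
Proof. exact: is_deriveZ. Qed.

End IsDerive.

(** * Dominated series *)

Section Tannery.
Context {R : realType}.

Lemma norm_series_tail (u M : R^nat) m :
  (forall k, `|u k| <= M k) -> cvgn (series M) ->
  `|limn (series u) - series u m| <= limn (series M) - series M m.
Proof.
move=> uM cM.
have M0 k : 0 <= M k by exact: le_trans (uM k).
have cu : cvgn (series u).
  apply: normed_cvg; apply: (@series_le_cvg _ _ M) => //= k.
have h : (fun p => `|series u p - series u m|) @ \oo -->
    `|limn (series u) - series u m|.
  by apply: cvg_norm; apply: cvgB cu _; apply: cvg_cst.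
have h' : (fun p => series M p - series M m) @ \oo -->
    limn (series M) - series M m by apply: cvgB cM _; apply: cvg_cst.
apply: (ler_cvg_to h h'); near=> p.
have mp : (m <= p)%N by near: p; exists m.
rewrite !sub_series mp.
apply: le_trans (ler_norm_sum _ _ _) _.
by apply: ler_sum => k _.
Unshelve. all: by end_near. Qed.

(** Dominated convergence for series along an arbitrary filter; the filter is
left general so that the same statement covers one-sided limits and joint
continuity in several parameters. *)
Lemma tannery (T : Type) (F : set_system T) (u : T -> R^nat) (v M : R^nat) :
  Filter F -> cvgn (series M) ->
  (\forall x \near F, forall k, `|u x k| <= M k) ->
  (forall k, `|v k| <= M k) ->
  (forall k, u x k @[x --> F] --> v k) ->
  limn (series (u x)) @[x --> F] --> limn (series v).
Proof.
move=> FF cM uM vM uv; apply/cvgrPdist_lt => e e0.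
have e3 : 0 < e / 3 by lra.
have /cvgrPdist_lt/(_ _ e3)[m _ hm] := cM.
have {}hm := hm m (leqnn m).
have cs : series (u x) m @[x --> F] --> series v m.
  elim: m {hm} => [|m IH].
    by rewrite /series/= big_geq//; under eq_fun do rewrite big_geq//; exact: cvg_cst.
  rewrite seriesSr; under eq_fun do rewrite seriesSr.
  exact: cvgD.
have := uM; apply: filterS2; last first.
  by have /cvgrPdist_lt/(_ _ e3) := cs; exact.
move=> x hx uMx.
have h1 := norm_series_tail m uMx cM.
have h2 := norm_series_tail m vM cM.
have h3 := ler_norm (limn (series M) - series M m).
move: h1 h2 hx; set a := limn (series (u x)); set b := limn (series v).
set a' := series (u x) m; set b' := series v m.
move=> h1 h2 h4.
rewrite (_ : b - a = (b - b') + (b' - a') + (a' - a)); last by ring.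
apply: le_lt_trans (ler_normD _ _) _.
have := ler_normD (b - b') (b' - a'); rewrite (distrC a' a); lra.
Qed.

Lemma cvg_seriesMl (u v : R^nat) (r l : R) : (forall k, v k = r * u k) ->
  series u @ \oo --> l -> series v @ \oo --> r * l.
Proof.
move=> vu; rewrite (_ : series v = (fun k => r * series u k)); last first.
  by apply/funext => k; rewrite /series/= mulr_sumr; apply: eq_bigr.
exact: cvgMl_tmp.
Qed.

Lemma ratio_majorant (M : R^nat) (r : R) (J : nat) : 0 < r ->
  (forall k, 0 <= M k) ->
  (forall k, (J <= k)%N -> M k.+1 <= r * M k) ->
  exists C, 0 <= C /\ forall k, M k <= C * r ^+ k.
Proof.
move=> r0 M0 Mr; pose C := \sum_(j < J.+1) M j / r ^+ j.
exists C; split; first by apply: sumr_ge0 => j _; rewrite divr_ge0// exprn_ge0// ltW.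
have C1 k : (k <= J)%N -> M k <= C * r ^+ k.
  move=> kJ; rewrite -ler_pdivrMr ?exprn_gt0//.
  rewrite /C (bigD1 (Ordinal (kJ : (k < J.+1)%N)))//= lerDl.
  by apply: sumr_ge0 => j _; rewrite divr_ge0// exprn_ge0// ltW.
elim=> [|k IH]; first by apply: C1.
have [kJ|Jk] := leqP k.+1 J; first by apply: C1.
apply: le_trans (Mr k Jk) _.
by rewrite exprS mulrCA ler_wpM2l// ltW.
Qed.

Lemma ratio_test (M : R^nat) (r : R) (J : nat) : 0 < r < 1 ->
  (forall k, 0 <= M k) ->
  (forall k, (J <= k)%N -> M k.+1 <= r * M k) -> cvgn (series M).
Proof.
move=> /andP[r0 r1] M0 Mr.
have [C [C0 hC]] := ratio_majorant r0 M0 Mr.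
apply: (@series_le_cvg _ _ (geometric C r)) => // [k|].
  by rewrite /geometric/= mulr_ge0// exprn_ge0// ltW.
by apply: is_cvg_geometric_series; rewrite ger0_norm// ltW.
Qed.

End Tannery.

(** * Regular solutions of the hypergeometric family *)

Section Radial.
Context {R : realType}.
Implicit Types (a b c s t : R).

(** The coefficients are those of the power series solution of
t (1 - a t) y'' + (c - 2 a c t) y' + b y = 0 with y(0) = 1: for a = 1 this is a
Gauss hypergeometric series, for a = 0 a Bessel-Clifford series. *)
Definition radial_coef c a b : R^nat := fun k =>
  \prod_(j < k)
    ((a * (j%:R * (j%:R + 2 * c - 1)) - b) / (j.+1%:R * (j%:R + c))).

Definition radial c a b t : R := limn (pseries (radial_coef c a b) t).

Definition radial_majorant c (T S : R) : R^nat := fun k =>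
  \prod_(j < k)
    ((T * (j%:R * (j%:R + 2 * c + 1)) + S) / (j.+1%:R * (j%:R + c))).

Lemma radial_coefS c a b k : 0 < c ->
  (k.+1%:R * (k%:R + c)) * radial_coef c a b k.+1 =
  (a * (k%:R * (k%:R + 2 * c - 1)) - b) * radial_coef c a b k.
Proof.
move=> c0; rewrite /radial_coef big_ord_recr/=.
have h1 : (k.+1%:R : R) != 0 by rewrite pnatr_eq0.
have h2 : k%:R + c != 0 by rewrite gt_eqF// ltr_wpDl// ler0n.
by rewrite mulrCA -[X in _ * X = _]mulrC mulfVK ?mulf_neq0// mulrC.
Qed.

Lemma radial_coef_scale c a b t k :
  radial_coef c a b k * t ^+ k = radial_coef c (a * t) (b * t) k.
Proof.
rewrite /radial_coef -[in t ^+ k](card_ord k) -prodr_const -big_split/=.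
by apply: eq_bigr => j _; ring.
Qed.

(** The ratio of consecutive terms tends to T < 1; (1 + T) / 2 bounds it from
some rank on. *)
Lemma radial_majorant_cvg c T S : 0 < c -> 0 <= T < 1 -> 0 <= S ->
  cvgn (series (radial_majorant c T S)).
Proof.
move=> c0 /andP[T0 T1] S0.
pose r := (1 + T) / 2.
have rT : 0 < r - T by rewrite /r; lra.
pose J := (Num.trunc ((T * (2 * c + 1) + S) / (r - T))).+1.
have hJ : (T * (2 * c + 1) + S) / (r - T) < J%:R by exact: truncnS_gt.
apply: (@ratio_test _ _ r J).
- by rewrite /r; apply/andP; split; lra.
- move=> k; apply: prodr_ge0 => j _; rewrite divr_ge0//.
    by rewrite addr_ge0// mulr_ge0// mulr_ge0// !addr_ge0// mulr_ge0// ltW.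
  by rewrite mulr_ge0// addr_ge0// ltW.
- move=> k Jk; rewrite /radial_majorant big_ord_recr/= mulrC.
  apply: ler_wpM2r.
    apply: prodr_ge0 => j _; rewrite divr_ge0//.
      by rewrite addr_ge0// mulr_ge0// mulr_ge0// !addr_ge0// mulr_ge0// ltW.
    by rewrite mulr_ge0// addr_ge0// ?ler0n// ltW.
  have k1 : 1 <= k%:R :> R by rewrite ler1n (leq_trans _ Jk).
  have h : T * (2 * c + 1) + S <= (r - T) * k%:R.
    rewrite [leRHS]mulrC -ler_pdivrMr//; apply/ltW/(lt_le_trans hJ).
    by rewrite ler_nat.
  rewrite ler_pdivrMr; last by rewrite mulr_gt0// ltr_wpDl.
  rewrite -natr1; have r0 : 0 < r by rewrite /r; lra.
  have := ler_wpM2r (ler0n R k) h.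
  have : S <= S * k%:R by rewrite ler_peMr.
  have := mulr_ge0 (ltW r0) (ltW c0); have := mulr_ge0 (ltW r0) (ler0n R k).
  have := mulr_ge0 (mulr_ge0 (ltW r0) (ltW c0)) (ler0n R k).
  nra.
Qed.

Lemma radial_coef_le c a b T S k : 0 < c -> `|a| <= T -> `|b| <= S ->
  `|radial_coef c a b k| <= radial_majorant c T S k.
Proof.
move=> c0 aT bS; rewrite normr_prod; apply: ler_prod => j _.
rewrite normr_ge0/= normrM normfV (ger0_norm (_ : 0 <= _ * _)); last first.
  by rewrite mulr_ge0// addr_ge0// ltW.
rewrite ler_wpM2r// ?invr_ge0 ?mulr_ge0 ?addr_ge0 ?(ltW c0)//.
apply: le_trans (ler_normB _ _) _; rewrite lerD//.
rewrite normrM; apply: ler_pM => //.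
rewrite normrM ger0_norm// ler_wpM2l//.
have j0 := ler0n R j.
by rewrite ler_norml; apply/andP; split; lra.
Qed.

Lemma radial_cvg c a b t : 0 < c -> `|a * t| < 1 ->
  cvgn (pseries (radial_coef c a b) t).
Proof.
move=> c0 at1; rewrite /pseries.
rewrite (_ : (fun i => _) = radial_coef c (a * t) (b * t)); last first.
  by apply/funext => k; rewrite radial_coef_scale.
apply: normed_cvg; apply: (@series_le_cvg _ _
    (radial_majorant c `|a * t| `|b * t|)) => //=.
- move=> k; exact: le_trans (radial_coef_le _ c0 (lexx _) (lexx _)).
- by move=> k; exact: radial_coef_le.
- by apply: radial_majorant_cvg => //; rewrite normr_ge0.
Qed.

Lemma radial_scale c a b t : radial c a b t = radial c (a * t) (b * t) 1.
Proof.
rewrite /radial /pseries; congr (limn (series _)); apply/funext => k.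
by rewrite /= expr1n mulr1 radial_coef_scale.
Qed.

(** The term-by-term derivative is again a series of the family.  So one
convergence statement covers the derivatives of all orders. *)
Lemma radial_diffs c a b : 0 < c ->
  pseries_diffs (radial_coef c a b) =
  (fun k => - (b / c) * radial_coef (c + 1) a (b - 2 * a * c) k).
Proof.
move=> c0; apply/funext; elim => [|k IH].
  rewrite /pseries_diffs /radial_coef big_ord_recr !big_ord0/=.
  by field; rewrite gt_eqF.
have c10 : 0 < c + 1 by lra.
have kc : k%:R + c + 1 != 0.
  by rewrite gt_eqF//; have := ler0n R k; lra.
have h1 := radial_coefS a b k.+1 c0.
have := radial_coefS a (b - 2 * a * c) k c10.
rewrite (addrA k%:R) => h2.
have k1 : (k.+1%:R : R) != 0 by rewrite pnatr_eq0.
apply: (mulfI (_ : k.+1%:R * (k%:R + c + 1) != 0)); first by rewrite mulf_neq0.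
rewrite [RHS]mulrCA h2 [RHS]mulrCA -IH /pseries_diffs.
move: h1; rewrite -![_.+1%:R]natr1 => h1.
transitivity ((k%:R + 1) * ((k%:R + 1 + 1) * (k%:R + 1 + c) * radial_coef c a b k.+2)).
  by ring.
by rewrite h1; ring.
Qed.

Lemma radial_diffs_cvg c a b t : 0 < c -> `|a * t| < 1 ->
  cvgn (pseries (pseries_diffs (radial_coef c a b)) t).
Proof.
move=> c0 at1; have c10 : 0 < c + 1 by lra.
rewrite radial_diffs// /pseries.
apply: cvgP; apply: (cvg_seriesMl (r := - (b / c))
    (u := fun k => radial_coef (c + 1) a (b - 2 * a * c) k * t ^+ k) _
    (@radial_cvg (c + 1) a (b - 2 * a * c) _ c10 at1)) => k /=.
by rewrite mulrA.
Qed.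

(** The first two derivatives of [radial c a b], as the shift of parameters in
[radial_diffs] gives them. *)
Definition radial1 c a b t := - (b / c) * radial (c + 1) a (b - 2 * a * c) t.
Definition radial2 c a b t := - (b / c) *
  radial1 (c + 1) a (b - 2 * a * c) t.

Lemma radial_is_derive c a b t : 0 < c -> `|a * t| < 1 ->
  is_derive t 1 (radial c a b) (radial1 c a b t).
Proof.
move=> c0 at1; have c10 : 0 < c + 1 by lra.
have -> : radial1 c a b t =
    limn (pseries (pseries_diffs (radial_coef c a b)) t).
  rewrite radial_diffs// /pseries /radial1 /radial; apply/esym/cvg_lim => //.
  apply: (cvg_seriesMl (r := - (b / c))
    (u := fun k => radial_coef (c + 1) a (b - 2 * a * c) k * t ^+ k) _
    (@radial_cvg (c + 1) a (b - 2 * a * c) _ c10 at1)) => k /=.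
  by rewrite mulrA.
(* a point K strictly between t and the radius of convergence *)
have [K tK aK] : exists2 K, `|t| < `|K| & `|a * K| < 1.
  have [a0|a0] := eqVneq a 0.
    exists (`|t| + 1); rewrite ?a0 ?mul0r ?normr0//.
    by rewrite [X in _ < X]ger0_norm ?addr_ge0// ltrDl.
  exists ((`|t| + `|a|^-1) / 2).
    rewrite [X in _ < X]ger0_norm ?divr_ge0 ?addr_ge0 ?invr_ge0//.
    have : `|t| < `|a|^-1.
      by rewrite -[X in _ < X]mul1r ltr_pdivlMr ?normr_gt0// -normrM mulrC.
    lra.
  rewrite normrM [X in _ * X]ger0_norm ?divr_ge0 ?addr_ge0 ?invr_ge0//.
  rewrite mulrA mulrDr mulfV ?normr_eq0// -normrM; lra.
rewrite /radial; apply: (pseries_snd_diffs (K := K)) => //.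
- exact: radial_cvg.
- exact: radial_diffs_cvg.
- rewrite radial_diffs// /pseries; apply: cvgP; apply: (cvg_seriesMl (r := - (b / c))
    (u := fun k => pseries_diffs (radial_coef (c + 1) a (b - 2 * a * c)) k * K ^+ k) _
    (@radial_diffs_cvg (c + 1) a (b - 2 * a * c) _ c10 aK)) => k /=.
  by rewrite /pseries_diffs; ring.
Qed.

Lemma radial_at0 c a b : radial c a b 0 = 1.
Proof.
rewrite /radial /pseries.
apply: cvg_lim => //.
apply: cvg_near_cst; exists 1%N => // -[//|k] _.
rewrite /series/= big_nat_recl//= /radial_coef big_ord0 expr0 mulr1.
by rewrite big1 ?addr0// => i _; rewrite expr0n mulr0.
Qed.

Lemma cvg_series_shift (u : R^nat) (l : R) :
  series u @ \oo --> l ->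
  series (fun k => if k is k'.+1 then u k' else 0) @ \oo --> l.
Proof.
move=> h; rewrite -cvg_shiftS.
rewrite (_ : [sequence _]_n = series u)//; apply/funext => k.
by rewrite /series/= big_nat_recl//= add0r.
Qed.

Lemma radial1_is_derive c a b t : 0 < c -> `|a * t| < 1 ->
  is_derive t 1 (radial1 c a b) (radial2 c a b t).
Proof.
move=> c0 at1; have c10 : 0 < c + 1 by lra.
have := radial_is_derive (b - 2 * a * c) c10 at1.
move=> h; exact: (is_deriveMl (- (b / c)) h).
Qed.

Lemma radial2_is_derive c a b t : 0 < c -> `|a * t| < 1 ->
  derivable (radial2 c a b) t 1.
Proof.
move=> c0 at1; have c10 : 0 < c + 1 by lra.
have h := radial1_is_derive (b - 2 * a * c) c10 at1.
exact: (is_derive_derivable (is_deriveMl (- (b / c)) h)).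
Qed.

Lemma radial1_cvg c a b t : 0 < c -> `|a * t| < 1 ->
  series (fun k => k.+1%:R * radial_coef c a b k.+1 * t ^+ k) @ \oo --> radial1 c a b t.
Proof.
move=> c0 at1; have c10 : 0 < c + 1 by lra.
apply: (cvg_seriesMl (r := - (b / c))
    (u := fun k => radial_coef (c + 1) a (b - 2 * a * c) k * t ^+ k) _
    (@radial_cvg (c + 1) a (b - 2 * a * c) _ c10 at1)) => k /=.
have /(congr1 (fun f => f k)) := radial_diffs a b c0.
by rewrite /pseries_diffs => ->; rewrite mulrA.
Qed.

Lemma radial2_cvg c a b t : 0 < c -> `|a * t| < 1 ->
  series (fun k => k.+1%:R * (k.+2%:R * radial_coef c a b k.+2) * t ^+ k)
    @ \oo --> radial2 c a b t.
Proof.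
move=> c0 at1; have c10 : 0 < c + 1 by lra.
apply: cvg_seriesMl _ (@radial1_cvg (c + 1) a (b - 2 * a * c) _ c10 at1) => k.
have /(congr1 (fun f => f k.+1)) := radial_diffs a b c0.
by rewrite /pseries_diffs => ->; ring.
Qed.

(** Each power of t in the equation is accounted for by a shift of the
coefficient series; the recurrence [radial_coefS] then cancels the combination
term by term. *)
Lemma radial_ode c a b t : 0 < c -> `|a * t| < 1 ->
  t * (1 - a * t) * radial2 c a b t + (c - 2 * a * c * t) * radial1 c a b t
  + b * radial c a b t = 0.
Proof.
move=> c0 at1.
pose h := radial_coef c a b.
have H0 := @radial_cvg c a b t c0 at1.
have H1 := @radial1_cvg c a b t c0 at1.
have H2 := @radial2_cvg c a b t c0 at1.
have tH1 := cvg_series_shift H1.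
have tH2 := cvg_series_shift H2.
have ttH2 := cvg_series_shift tH2.
set D2 := radial2 c a b t; set D1 := radial1 c a b t; set D0 := radial c a b t.
pose A k : R := if k is k'.+1 then k'.+1%:R * (k'.+2%:R * h k'.+2) * t ^+ k' else 0.
pose B k : R := if k is k'.+1 then A k' else 0.
pose C k : R := if k is k'.+1 then k'.+1%:R * h k'.+1 * t ^+ k' else 0.
have H : (fun N => t * series A N + (- a * t ^+ 2) * series B N
    + c * series (fun k => k.+1%:R * h k.+1 * t ^+ k) N
    + (- 2 * a * c * t) * series C N
    + b * pseries h t N) @ \oo --> t * D2 + (- a * t ^+ 2) * D2 + c * D1
    + (- 2 * a * c * t) * D1 + b * D0.
  by repeat apply: cvgD; apply: cvgMl_tmp.
have Z : (fun N => t * series A N + (- a * t ^+ 2) * series B N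
    + c * series (fun k => k.+1%:R * h k.+1 * t ^+ k) N
    + (- 2 * a * c * t) * series C N
    + b * pseries h t N) = fun=> 0.
  apply/funext => N; rewrite /pseries /series/= !mulr_sumr -!big_split/=.
  apply: big1_seq => k _.
  have hk := radial_coefS a b k c0; rewrite -/h in hk.
  move/eqP: hk; rewrite -subr_eq0 => /eqP.
  case: k => [|[|k]] hk; rewrite /C /B /A ?expr0 ?expr1 ?exprS.
  - by rewrite -[RHS]hk /=; ring.
  - by rewrite -[RHS](mulr0 t) -[in RHS]hk; ring.
  - by rewrite -[RHS](mulr0 (t * t * t ^+ k)) -[in RHS]hk -!natr1; ring.
rewrite Z in H; have := cvg_unique _ H (cvg_cst 0).
move=> /(_ (@Rhausdorff R)) E0.
rewrite -[RHS]E0; ring.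
Qed.

(** Joint continuity of the family in the homogeneous parameters a * t and
b * t, including the Bessel case a = 0. *)
Lemma radial_continuous c (T : Type) (F : set_system T) (f g : T -> R) (a b : R) :
  Filter F -> 0 < c -> `|a| < 1 -> f @ F --> a -> g @ F --> b ->
  radial c (f x) (g x) 1 @[x --> F] --> radial c a b 1.
Proof.
move=> FF c0 a1 fa gb.
have E a' b' : radial c a' b' 1 = limn (series (radial_coef c a' b')).
  rewrite /radial /pseries; congr (limn (series _)).
  by apply/funext => k; rewrite /= expr1n mulr1.
rewrite E; under eq_fun do rewrite E.
pose T0 := (1 + `|a|) / 2.
have T01 : 0 <= T0 < 1.
  by rewrite /T0; have := normr_ge0 a; move=> ?; apply/andP; split; lra.
apply: (@tannery _ _ F (fun x => radial_coef c (f x) (g x))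
   (radial_coef c a b) (radial_majorant c T0 (`|b| + 1))).
- exact: radial_majorant_cvg.
- have fn : `|f x| @[x --> F] --> `|a| by exact: cvg_norm.
  have gn : `|g x| @[x --> F] --> `|b| by exact: cvg_norm.
  have h1 : \forall x \near F, `|f x| <= T0.
    by apply: (cvgr_le _ fn); rewrite /T0; lra.
  have h2 : \forall x \near F, `|g x| <= `|b| + 1.
    by apply: (cvgr_le _ gn); rewrite ltrDl.
  apply: filterS2 h1 h2 => x h1 h2 k; exact: radial_coef_le.
- move=> k; apply: radial_coef_le => //; rewrite /T0; lra.
- rewrite /radial_coef; elim => [|k IH].
    by rewrite big_ord0; under eq_fun do rewrite big_ord0; exact: cvg_cst.
  rewrite big_ord_recr/=; under eq_fun do rewrite big_ord_recr/=.
  apply: cvgM => //; apply: cvgMr_tmp; apply: cvgB => //.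
  exact: cvgMr_tmp.
Qed.

End Radial.

(** * Sign of the derivative of a radial solution *)

Section Monotone.
Context {R : realType}.

Lemma is_derive_continuous (f : R -> R) (x df : R) :
  is_derive x 1 f df -> {for x, continuous f}.
Proof.
move=> h; apply: differentiable_continuous.
by apply/derivable1_diffP; exact: ex_derive.
Qed.

Lemma MVT_is_derive (f df : R -> R) (a b : R) : a < b ->
  (forall x, a <= x <= b -> is_derive x 1 f (df x)) ->
  exists2 x, a < x < b & f b - f a = df x * (b - a).
Proof.
move=> ab h.
have [y|y|x xab ->] := MVT ab (f := f) (df := df).
- by rewrite in_itv/= => /andP[ay yb]; apply: h; rewrite !ltW.
- apply: derivable_within_continuous => x; rewrite in_itv/= => xab.
  exact: (is_derive_derivable (h x xab)).
- by exists x => //; move: xab; rewrite in_itv.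
Qed.

(** In divergence form, with q = t (1 - a t), the equation reads
(q^c y')' = - b q^(c - 1) y.  So q^c y' decreases as long as y > 0, and y' stays
negative up to and including the first zero of y. *)
Lemma radial1_lt0 (c a b s : R) : 0 < c -> 0 < b -> 0 <= a -> a * s < 1 ->
  (forall t, 0 <= t < s -> 0 < radial c a b t) ->
  forall t, 0 < t <= s -> radial1 c a b t < 0.
Proof.
move=> c0 b0 a0 as1 ypos t /andP[t0 ts].
have at1 x : 0 <= x <= t -> `|a * x| < 1.
  move=> /andP[x0 xt]; rewrite ger0_norm ?mulr_ge0//.
  by apply: le_lt_trans as1; rewrite ler_wpM2l// (le_trans xt).
(* y' < 0 next to 0, since y'(0) = - b / c *)
have [d /andP[d0 dt] yd] : exists2 d, 0 < d <= t & radial1 c a b d < 0.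
  have h := is_derive_continuous (radial1_is_derive b c0 (at1 0 _)).
  have {h} : {for 0, continuous (radial1 c a b)} by apply: h; rewrite lexx ltW.
  have y0 : radial1 c a b 0 < 0.
    by rewrite /radial1 radial_at0 mulr1 oppr_lt0 divr_gt0.
  move=> /cvgr_lt/(_ _ y0)[e /= e0 he].
  exists (Num.min t (e / 2)).
    by rewrite lt_min t0 divr_gt0//= ge_min lexx.
  apply: he; rewrite /= sub0r normrN ger0_norm; last by rewrite le_min !ltW// divr_gt0.
  by rewrite gt_min; apply/orP; right; lra.
have [->//|] := eqVneq t d; rewrite neq_lt ltNge dt/= => {}dt.
pose q x := x * (1 - a * x).
have q0 x : 0 < x <= t -> 0 < q x.
  move=> /andP[x0 xt]; rewrite mulr_gt0// subr_gt0.
  by apply: le_lt_trans as1; rewrite ler_wpM2l// (le_trans xt).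
pose P x := q x `^ c * radial1 c a b x.
have dP x : d <= x <= t -> is_derive x 1 P (- b * q x `^ (c - 1) * radial c a b x).
  move=> /andP[dx xt].
  have x0 : 0 < x by exact: lt_le_trans dx.
  have qx : 0 < q x by apply: q0; rewrite x0.
  have ax : `|a * x| < 1 by apply: at1; rewrite xt ltW.
  have dq : is_derive x 1 q (1 - 2 * a * x).
    rewrite /q; apply: is_derive_eq.
    by rewrite /GRing.scale/=; ring.
  have dqc := is_derive1_comp (is_derive1_powR c qx) dq.
  have dy := radial1_is_derive b c0 ax.
  have := is_deriveM dqc dy.
  move=> /is_derive_eq; apply.
  have /eqP := radial_ode b c0 ax; rewrite addr_eq0 => /eqP ode.
  have qc : q x `^ c = q x * q x `^ (c - 1).
    by rewrite -[X in X * _]powRr1 ?(ltW qx)// -powRD ?(gt_eqF qx) ?implybT// addrC subrK.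
  rewrite /GRing.scale/= qc.
  transitivity (q x `^ (c - 1) * (x * (1 - a * x) * radial2 c a b x
     + (c - 2 * a * c * x) * radial1 c a b x)); first by rewrite /q; ring.
  by rewrite ode; ring.
have [x /andP[dx xt] E] := MVT_is_derive dt dP.
have : P t < 0.
  apply: (@lt_trans _ _ (P d)).
    rewrite -subr_lt0 E nmulr_rlt0 ?subr_gt0//.
    have x0 : 0 < x by exact: lt_trans dx.
    rewrite -mulrA mulNr oppr_lt0 !mulr_gt0//.
      by rewrite powR_gt0// q0// x0 ltW.
    by apply: ypos; rewrite (lt_le_trans xt ts) ltW.
  by rewrite pmulr_rlt0// powR_gt0// q0// d0 ltW.
by rewrite pmulr_rlt0// powR_gt0// q0// t0 lexx.
Qed.

End Monotone.

(** * First zero of the Bessel-Clifford function *)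

Section FirstZero.
Context {R : realType}.

Lemma first_zero (f : R -> R) (s : R) : 0 <= s ->
  (forall t, 0 <= t <= s -> {for t, continuous f}) -> 0 < f 0 -> f s <= 0 ->
  exists s1, [/\ 0 < s1 <= s, f s1 = 0 & forall t, 0 <= t < s1 -> 0 < f t].
Proof.
move=> s0 fc f0 fs.
pose S := [set t : R | 0 <= t <= s /\ f t <= 0].
have Ss : S s by split; rewrite ?s0 ?lexx.
have S0 : has_inf S by split; [exists s|exists 0 => t [/andP[]]].
have lbS t : S t -> inf S <= t by move=> St; apply: ge_inf => //; case: S0.
have i0 : 0 <= inf S by apply: lb_le_inf; [exists s|move=> t [/andP[]]].
have is1 : inf S <= s by exact: lbS.
have pos t : 0 <= t < inf S -> 0 < f t.
  move=> /andP[t0 ti]; rewrite ltNge; apply/negP => ft.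
  have : S t by split => //; rewrite t0 (le_trans (ltW ti)).
  by move=> /lbS; rewrite leNgt ti.
have fi : {for inf S, continuous f} by apply: fc; rewrite i0.
have fle : f (inf S) <= 0.
  rewrite leNgt; apply/negP => fi0.
  have /(@cvgr_gt _ _ _ _ f)/(_ _ fi0)[e /= e0 he] := fi.
  have : inf S + e <= inf S.
    apply: lb_le_inf; first by exists s.
    move=> t St; rewrite leNgt; apply/negP => te.
    have it := lbS t St; case: St => _; rewrite leNgt => /negP; apply.
    by apply: (he t); rewrite /= ler0_norm ?subr_le0//; lra.
  by rewrite gerDl leNgt e0.
have ipos : 0 < inf S.
  by rewrite lt_neqAle i0 andbT; apply/eqP => E; rewrite -E leNgt f0 in fle.
exists (inf S); split => //; first by rewrite ipos.
apply/eqP; rewrite eq_le fle/= leNgt; apply/negP => fi0.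
have /(@cvgr_lt _ _ _ _ f)/(_ _ fi0)[e /= e0 he] := fi.
pose t := Num.max 0 (inf S - e / 2).
have ti : t < inf S by rewrite gt_max ipos/=; lra.
have t0 : 0 <= t by rewrite le_max lexx.
have te : inf S - e / 2 <= t by rewrite le_max lexx orbT.
have := pos t; rewrite t0 ti => /(_ isT); rewrite ltNge => /negP; apply.
by apply/ltW/he; rewrite /= ger0_norm; lra.
Qed.

(** If y stayed positive, then y' < 0 and z = - y / y' would be positive and
satisfy the Riccati equation z' = - 1 + (c z - z^2) / t.  As c z - z^2 <= c^2 / 4,
this gives z' <= - 1 / 2 for t >= c^2 / 2, and z would become negative. *)
Lemma radial_bessel_zero (c : R) : 0 < c ->
  exists2 s : R, 0 <= s & radial c 0 1 s <= 0.
Proof.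
move=> c0; apply: contrapT => noz.
have ypos (t : R) : 0 <= t -> 0 < radial c 0 1 t.
  by move=> t0; rewrite ltNge; apply/negP => yt; apply: noz; exists t.
have a1 (t : R) : `|0 * t| < 1 by rewrite mul0r normr0.
have y1 (t : R) : 0 < t -> radial1 c 0 1 t < 0.
  move=> t0; apply: (@radial1_lt0 _ c 0 1 t) => //; rewrite ?mul0r ?t0 ?lexx//.
  by move=> u /andP[u0 _]; exact: ypos.
pose z (t : R) := - (radial c 0 1 t / radial1 c 0 1 t).
have zpos (t : R) : 0 < t -> 0 < z t.
  by move=> t0; rewrite /z oppr_gt0 pmulr_rlt0 ?invr_lt0 ?y1// ypos// ltW.
pose dz (t : R) := - 1 + (c * z t - z t ^+ 2) / t.
have dzP (t : R) : 0 < t -> is_derive t 1 z (dz t).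
  move=> t0.
  have n0 : radial1 c 0 1 t != 0 by rewrite lt_eqF// y1.
  have d0 := @radial_is_derive _ c 0 1 t c0 (a1 t).
  have d1 := @radial1_is_derive _ c 0 1 t c0 (a1 t).
  have d1V : is_derive t 1 (fun t => (radial1 c 0 1 t)^-1)
      (- (radial1 c 0 1 t) ^- 2 *: radial2 c 0 1 t).
    by have := d1; exact: is_deriveV.
  have := is_deriveN (is_deriveM d0 d1V).
  move=> /is_derive_eq; apply.
  have /eqP := radial_ode 1 c0 (a1 t).
  rewrite mul1r !mulr0 !mul0r !subr0 mulr1 => /eqP ode.
  have y2 : radial2 c 0 1 t = - (c * radial1 c 0 1 t + radial c 0 1 t) / t.
    have -> : - (c * radial1 c 0 1 t + radial c 0 1 t) = t * radial2 c 0 1 t by lra.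
    by rewrite mulrC mulKf// gt_eqF.
  rewrite /GRing.scale/= y2 /dz /z.
  by field; rewrite n0 gt_eqF.
pose s0 := Num.max 1 (c ^+ 2 / 2).
have s1 : 1 <= s0 by rewrite le_max lexx.
have sc : c ^+ 2 / 2 <= s0 by rewrite le_max lexx orbT.
pose s2 := s0 + 2 * z s0 + 1.
have z0 : 0 < z s0 by apply: zpos; lra.
have s02 : s0 < s2 by rewrite /s2; lra.
have [x /andP[x0 _] E] : exists2 x : R, s0 < x < s2 & z s2 - z s0 = dz x * (s2 - s0).
  apply: MVT_is_derive => // x /andP[x0 _]; apply: dzP; lra.
have xp : 0 < x by lra.
have dzx : dz x <= - (1 / 2).
  rewrite /dz; suff : (c * z x - z x ^+ 2) / x <= 1 / 2 by lra.
  rewrite ler_pdivrMr//.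
  have := sqr_ge0 (z x - c / 2); rewrite !expr2; rewrite expr2 in sc.
  nra.
have z2 : 0 < z s2 by apply: zpos; lra.
have s20 : 0 <= s2 - s0 by rewrite subr_ge0 ltW.
have := ler_wpM2r s20 dzx; rewrite -E.
have s2E : s2 - s0 = 2 * z s0 + 1 by rewrite /s2; ring.
rewrite s2E; lra.
Qed.

Lemma radial_continuous_arg (c a b t : R) : 0 < c -> `|a * t| < 1 ->
  {for t, continuous (radial c a b)}.
Proof.
by move=> c0 at1; apply: is_derive_continuous (radial_is_derive b c0 at1).
Qed.

(** The derivative is negative at the first zero, so the function changes sign
there; a mere zero would not be stable under the perturbation to come. *)
Lemma radial_bessel_first_zero (c : R) : 0 < c ->
  exists s1 : R, [/\ 0 < s1, radial c 0 1 s1 = 0,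
    forall t, 0 <= t < s1 -> 0 < radial c 0 1 t &
    forall d, 0 < d -> exists2 t, s1 < t < s1 + d & radial c 0 1 t < 0].
Proof.
move=> c0.
have a1 (t : R) : `|0 * t| < 1 by rewrite mul0r normr0.
have [s s0 ys] := radial_bessel_zero c0.
have [|||s1 [/andP[s10 s1s] ys1 ypos]] := @first_zero (radial c 0 1) s s0 => //.
- by move=> t _; exact: radial_continuous_arg.
- by rewrite radial_at0.
exists s1; split => // d d0.
have y1 : radial1 c 0 1 s1 < 0.
  by apply: (@radial1_lt0 _ c 0 1 s1) => //; rewrite ?mul0r ?s10 ?lexx.
have := is_derive_continuous (@radial1_is_derive _ c 0 1 s1 c0 (a1 _)).
move=> /cvgr_lt/(_ _ y1)[e /= e0 he].
pose m := Num.min d e / 2.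
have me : Num.min d e <= e by rewrite ge_min lexx orbT.
have md : Num.min d e <= d by rewrite ge_min lexx.
have m0 : 0 < Num.min d e by rewrite lt_min d0.
exists (s1 + m); first by rewrite /m; apply/andP; split; lra.
have s1m : s1 < s1 + m by rewrite /m; lra.
have [x /andP[x0 x1] E] := MVT_is_derive s1m
  (fun x _ => @radial_is_derive _ c 0 1 x c0 (a1 x)).
move: E; rewrite ys1 subr0 => ->.
rewrite pmulr_llt0; last by lra.
apply: he => /=; rewrite ltr0_norm; rewrite /m in x1; lra.
Qed.

End FirstZero.

(** * The first spectral parameter of an interval *)

Section FirstEigenvalue.
Context {R : realType}.

Lemma radial_b0 (c t : R) : 0 < c -> `|t| < 1 -> radial c 1 0 t = 1.
Proof.
move=> c0 t1; rewrite /radial /pseries.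
apply: cvg_lim => //; apply: cvg_near_cst; exists 1%N => // -[//|k] _.
rewrite /series/= big_nat_recl//= /radial_coef big_ord0 expr0 mulr1.
rewrite big1 ?addr0// => i _; rewrite big_ord_recl/=.
by rewrite mul0r mulr0 subr0 !mul0r.
Qed.

(** The least l for which the solution is nonpositive somewhere on [0, t0]
exists by compactness of [0, L] x [0, t0].  At this l the solution is still
nonnegative on [0, t0], as a limit of positive functions, so that its first zero
cannot lie before t0, where it would cross 0. *)
Lemma radial_first_parameter (c t0 L : R) : 0 < c -> 0 < t0 < 1 -> 0 <= L ->
  radial c 1 L t0 <= 0 ->
  exists l, [/\ 0 < l <= L, radial c 1 l t0 = 0 &
    forall l', 0 <= l' < l -> forall t, 0 <= t <= t0 -> 0 < radial c 1 l' t].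
Proof.
move=> c0 /andP[t00 t01] L0 yL.
(* the second coordinate is truncated to [0, t0], where the series converges, to
   get a function that is continuous on the whole plane *)
pose g (p : R * R) := Num.max 0 (Num.min p.2 t0).
have g01 p : 0 <= g p <= t0.
  by rewrite /g le_max lexx/= ge_max (ltW t00)/= ge_min lexx orbT.
have gn p : `|g p| < 1.
  by have /andP[h1 h2] := g01 p; rewrite ger0_norm// (le_lt_trans h2).
pose f (p : R * R) := radial c 1 p.1 (g p).
have gid p : 0 <= p.2 <= t0 -> g p = p.2.
  by move=> /andP[h1 h2]; rewrite /g min_l// max_r.
have gc : continuous g.
  move=> p.
  have h : {for p, continuous ((fun=> 0 : R) \max ((fun q : R * R => q.2) \min (fun=> t0)))}.
    apply: continuous_max; first exact: cst_continuous.
    by apply: continuous_min; [exact: cvg_snd|exact: cst_continuous].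
  exact: h.
have fc : continuous f.
  move=> p.
  rewrite /continuous_at /f radial_scale; under eq_fun do rewrite radial_scale.
  have p1 : q.1 @[q --> p] --> p.1 by exact: cvg_fst.
  apply: radial_continuous => //; rewrite ?mul1r //.
  - by under eq_fun do rewrite mul1r; exact: gc.
  - by apply: cvgM => //; exact: gc.
pose K := (`[0, L]%classic `*` `[0, t0]%classic) `&` (f @^-1` [set x | x <= 0]).
have cK : compact K.
  apply: compact_closedI; first by apply: compact_setX; exact: segment_compact.
  by apply: preimage_closed; [move=> p _; exact: fc|exact: closed_le].
have K0 : K !=set0.
  exists (L, t0); split => /=; first by rewrite !in_itv/= L0 !lexx ltW.
  by rewrite /f gid//= lexx (ltW t00).
have [[l t1] /set_mem[[/= l0L t1t0] ft1] lmin] := compact_EVT_min K0 cK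
  (continuous_subspaceT (fun p => @cvg_fst _ _ (nbhs p.1) (nbhs p.2) _)).
move: l0L t1t0; rewrite !in_itv/= => /andP[l0 lL] /andP[t10 t1t0].
have {}ft1 : radial c 1 l t1 <= 0 by move: ft1; rewrite /f gid//= t10.
have pos l' : 0 <= l' < l -> forall t, 0 <= t <= t0 -> 0 < radial c 1 l' t.
  move=> /andP[l'0 l'l] t tt0; rewrite ltNge; apply/negP => yt.
  have : (l', t) \in K.
    apply/mem_set; split => /=; first by rewrite !in_itv/= l'0 tt0 (le_trans (ltW l'l)).
    by rewrite /f gid.
  by move=> /lmin/=; rewrite leNgt l'l.
have tn1 t : 0 <= t <= t0 -> `|t| < 1.
  by move=> /andP[h1 h2]; rewrite ger0_norm// (le_lt_trans h2).
have lgt0 : 0 < l.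
  rewrite lt_neqAle l0 andbT; apply/eqP => l00.
  by move: ft1; rewrite -l00 radial_b0 ?tn1 ?t10// ler10.
have ge0 t : 0 <= t <= t0 -> 0 <= radial c 1 l t.
  move=> tt0; rewrite leNgt; apply/negP => yt.
  have h : radial c 1 l' t @[l' --> l] --> radial c 1 l t.
    rewrite radial_scale; under eq_fun do rewrite radial_scale.
    apply: radial_continuous => //; rewrite ?mul1r ?tn1//; first exact: cvg_cst.
    by apply: cvgMr_tmp; exact: cvg_id.
  have := cvgr_lt _ h _ yt => -[e /= e0 he].
  pose l' := Num.max 0 (l - e / 2).
  have l'l : l' < l by rewrite gt_max lgt0/=; lra.
  have l'0 : 0 <= l' by rewrite le_max lexx.
  have l'e : l - e / 2 <= l' by rewrite le_max lexx orbT.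
  have : 0 < radial c 1 l' t by apply: pos => //; rewrite l'0.
  rewrite ltNge => /negP; apply; apply/ltW/he => /=.
  by rewrite ger0_norm; lra.
exists l; split => //; first by rewrite lgt0.
have [|||s [/andP[s0 st1] ys ypos]] := @first_zero _ (radial c 1 l) t1 t10 => //.
- move=> t /andP[h1 h2]; apply: radial_continuous_arg => //.
  by rewrite mul1r tn1// h1 (le_trans h2).
- by rewrite radial_at0.
have st0 : s <= t0 by exact: le_trans t1t0.
(* if s < t0, the derivative at s makes the solution negative just after s *)
have [<-//|] := eqVneq s t0; rewrite neq_lt ltNge [X in _ || X]ltNge st0 orbF.
rewrite -ltNge => {}st0.
have s1 : `|1 * s| < 1 by rewrite mul1r tn1// !ltW.
have y1 : radial1 c 1 l s < 0.
  apply: (@radial1_lt0 _ c 1 l s) => //; rewrite ?s0 ?lexx//.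
  by rewrite mul1r; exact: lt_trans t01.
have := is_derive_continuous (radial1_is_derive l c0 s1).
move=> /cvgr_lt/(_ _ y1)[e /= e0 he].
pose m := Num.min (t0 - s) e / 2.
have me : Num.min (t0 - s) e <= e by rewrite ge_min lexx orbT.
have md : Num.min (t0 - s) e <= t0 - s by rewrite ge_min lexx.
have m0 : 0 < Num.min (t0 - s) e by rewrite lt_min e0 andbT; lra.
have ssm : s < s + m by rewrite /m; lra.
have smt : s + m <= t0 by rewrite /m; lra.
have [|x /andP[x0 x1] E] := @MVT_is_derive _ (radial c 1 l) (radial1 c 1 l) _ _ ssm.
  move=> x /andP[x0 x1]; apply: radial_is_derive => //.
  by rewrite mul1r tn1//; apply/andP; split; lra.
have : 0 <= radial c 1 l (s + m) by apply: ge0; apply/andP; split; lra.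
move: E; rewrite ys subr0 => ->.
rewrite pmulr_lge0; last by lra.
rewrite leNgt => /negP; case; apply: he => /=.
by rewrite ltr0_norm; rewrite /m in x1; lra.
Qed.

End FirstEigenvalue.

(** * The Gamma function and the Bessel series *)

Section GammaFunction.
Context {R : realType}.
Notation mu := (@lebesgue_measure R).
Implicit Types (a z t C : R).

Let euler a t := t `^ a * expR (- t).

(** For a > 0, from u <= exp u at u = t / (2 a), raised to the power a. *)
Lemma euler_le a : 0 <= a ->
  exists2 C, 0 < C & forall t, 0 <= t -> euler a t <= C * expR (- (1 / 2) * t).
Proof.
move=> a0; have [-> | an0] := eqVneq a 0.
  exists 1 => // t t0; rewrite /euler powRr0 !mul1r ler_expR; lra.
have ap : 0 < a by rewrite lt_neqAle eq_sym an0.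
exists ((2 * a) `^ a); first by rewrite powR_gt0// mulr_gt0.
move=> t t0; rewrite /euler.
have tu : t <= 2 * a * expR (t / (2 * a)).
  rewrite mulrC -ler_pdivrMr ?mulr_gt0//.
  by apply: le_trans (expR_ge1Dx _); rewrite lerDr.
have : t `^ a <= (2 * a) `^ a * expR (t / 2).
  have -> : expR (t / 2) = expR (t / (2 * a)) `^ a.
    by rewrite /powR gt_eqF ?expR_gt0// expRK; congr expR; field.
  rewrite -powRM ?expR_ge0 ?mulr_ge0//.
  by apply: ge0_ler_powR => //; rewrite nnegrE// !mulr_ge0// expR_ge0.
move=> /(ler_wpM2r (expR_ge0 (- t))) /le_trans; apply.
rewrite -mulrA -expRD le_eqVlt; apply/orP; left; apply/eqP.
by congr (_ * expR _); field.
Qed.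

Lemma is_derive_expRM (k t : R) :
  is_derive t 1 (fun x => expR (k * x)) (k * expR (k * t)).
Proof.
have h : is_derive t 1 (fun x => k * x) k.
  by apply: is_derive_eq; rewrite /GRing.scale/= mulr1.
have := is_derive1_comp (is_derive_expR (k * t)) h.
by move=> /is_derive_eq; apply; rewrite mulrC.
Qed.

Lemma expR_cvg0y (k : R) : k < 0 -> expR (k * t) @[t --> +oo] --> 0.
Proof.
move=> k0.
rewrite (_ : (fun t => expR (k * t)) =
    (fun z => expR (- z)) \o (fun z => (- k) * z)); last first.
  by apply/funext => x /=; rewrite mulNr opprK.
apply: (@cvg_comp _ _ _ _ _ _ (pinfty_nbhs R)); last exact: cvgr_expR.
by apply: gt0_cvgMry => //; rewrite oppr_gt0.
Qed.

Lemma euler_is_derive a t : 0 < t ->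
  is_derive t 1 (euler a) (a * euler (a - 1) t - euler a t).
Proof.
move=> t0.
have h := is_derive_expRM (-1) t.
have h1 : is_derive t 1 (fun x => expR (- x)) (- expR (- t)).
  have -> : (fun x : R => expR (- x)) = (fun x => expR (-1 * x)).
    by apply/funext => x; rewrite mulN1r.
  by apply: is_derive_eq h _; rewrite !mulN1r.
have := is_deriveM (is_derive1_powR a t0) h1.
by move=> /is_derive_eq; apply; rewrite /euler /GRing.scale/=; ring.
Qed.

Lemma euler_continuous a : 0 <= a -> {within `[0, +oo[, continuous (euler a)}.
Proof.
move=> a0; apply/continuous_within_itvcyP; split.
  move=> t; rewrite in_itv/= andbT => t0.
  exact: is_derive_continuous (euler_is_derive a t0).
apply: cvgM.
  have [->|an0] := eqVneq a 0.
    by rewrite powRr0; under eq_fun do rewrite powRr0; exact: cvg_cst.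
  by rewrite powR0//; apply: powR_cvg0; rewrite lt_neqAle eq_sym an0.
apply: cvg_at_right_filter.
apply: (@is_derive_continuous _ (fun x => expR (- x)) 0 (- expR (- 0))).
have h := is_derive_expRM (-1) (0 : R).
have -> : (fun x : R => expR (- x)) = (fun x => expR (-1 * x)).
  by apply/funext => x; rewrite mulN1r.
by apply: is_derive_eq h _; rewrite !mulN1r.
Qed.

Lemma expR_half_integral (C : R) : 0 < C ->
  (\int[mu]_(t in `]0%R, +oo[) (C * expR (- (1 / 2) * t))%:E = (2 * C)%:E)%E.
Proof.
move=> C0.
have ce t : {for t, continuous (fun t => C * expR (- (1 / 2) * t))}.
  apply: (@is_derive_continuous _ _ _ (C * (- (1 / 2) * expR (- (1 / 2) * t)))).
  exact: (is_deriveMl C (is_derive_expRM _ _)).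
rewrite integral_itv_obnd_cbnd; last first.
  apply/measurable_EFinP; apply: measurable_funTS.
  exact: continuous_measurable_fun.
have dF t : is_derive t 1 (fun t => - (2 * C) * expR (- (1 / 2) * t))
    (C * expR (- (1 / 2) * t)).
  have := (is_deriveMl (- (2 * C)) (is_derive_expRM (- (1 / 2)) t)).
  by move=> /is_derive_eq; apply; rewrite /GRing.scale/=; field.
rewrite (@ge0_continuous_FTC2y _ _ (fun t => - (2 * C) * expR (- (1 / 2) * t)) _ 0).
- by rewrite mulr0 expR0 mulr1 EFinN oppeK add0e.
- by move=> t _; rewrite mulr_ge0 ?expR_ge0// ltW.
- exact: continuous_subspaceT.
- rewrite -[X in _ --> X](mulr0 (- (2 * C))); apply: cvgMl_tmp.
  by apply: expR_cvg0y; rewrite oppr_lt0.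
- by move=> t _; exact: (is_derive_derivable (dF t)).
- by apply: cvg_at_right_filter; exact: is_derive_continuous (dF 0).
- by move=> t _; rewrite derive1E; exact: (is_derive_val (dF t)).
Qed.

Lemma expR_half_integrable (C : R) : 0 < C ->
  mu.-integrable `]0%R, +oo[ (EFin \o (fun t => C * expR (- (1 / 2) * t))).
Proof.
move=> C0; apply/integrableP; split.
  apply/measurable_EFinP; apply: measurable_funTS.
  apply: continuous_measurable_fun => t.
  apply: (@is_derive_continuous _ _ _ (C * (- (1 / 2) * expR (- (1 / 2) * t)))).
  exact: (is_deriveMl C (is_derive_expRM _ _)).
have := expR_half_integral C0 => E.
under eq_integral => t _.
  rewrite /= ger0_norm; last by rewrite mulr_ge0 ?expR_ge0// ltW.
  over.
by rewrite E ltry.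
Qed.

Lemma euler_integrable a : 0 <= a ->
  mu.-integrable `]0%R, +oo[ (EFin \o euler a).
Proof.
move=> a0; have [C C0 hC] := euler_le a0.
apply: le_integrable (expR_half_integrable C0) => //.
  apply/measurable_EFinP; apply: measurable_funTS.
  apply: measurable_funM; first exact: measurable_powR.
  by apply: measurableT_comp => //; exact: measurable_oppr.
move=> t /=; rewrite in_itv/= andbT => t0.
rewrite lee_fin ger0_norm; last by rewrite mulr_ge0 ?powR_ge0 ?expR_ge0.
by rewrite ger0_norm ?hC ?ltW// mulr_gt0// expR_gt0.
Qed.

(** The function t^z exp(-t) vanishes at both ends, and integrating its
derivative gives the equation.  That derivative changes sign; so as to integrate
a nonnegative function over the half-line, the derivative of - 2 C exp(- t / 2)
is added to it, where C exp(- t / 2) dominates t^z exp(-t). *)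
Lemma GammaS (z : R) : 1 <= z -> Gamma (z + 1) = z * Gamma z.
Proof.
move=> z1; have z0 : 0 <= z by lra.
have [C C0 hC] := euler_le z0.
have z10 : 0 <= z - 1 by lra.
pose g t := C * expR (- (1 / 2) * t).
have dg t : is_derive t 1 (fun t => - (2 * C) * expR (- (1 / 2) * t)) (g t).
  have := (is_deriveMl (- (2 * C)) (is_derive_expRM (- (1 / 2)) t)).
  by move=> /is_derive_eq; apply; rewrite /GRing.scale/= /g; field.
have cg t : {for t, continuous g}.
  apply: (@is_derive_continuous _ _ _ (C * (- (1 / 2) * expR (- (1 / 2) * t)))).
  exact: (is_deriveMl C (is_derive_expRM _ _)).
pose F t := euler z t + - (2 * C) * expR (- (1 / 2) * t).
pose f t := z * euler (z - 1) t + (g t - euler z t).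
have dF t : 0 < t -> is_derive t 1 F (f t).
  move=> t0; have := is_deriveD (euler_is_derive z t0) (dg t).
  by move=> /is_derive_eq; apply; rewrite /f; ring.
have ig := expR_half_integrable C0.
have i1 := euler_integrable z10.
have i2 := euler_integrable z0.
have i1z : mu.-integrable `]0%R, +oo[ (EFin \o (fun t => z * euler (z - 1) t)).
  by have := @integrableZl _ _ _ mu _ (measurable_itv `]0%R, +oo[) z _ i1.
have ig2 : mu.-integrable `]0%R, +oo[ (EFin \o (fun t => g t - euler z t)).
  by have := @integrableB _ _ _ mu _ (measurable_itv `]0%R, +oo[) _ _ ig i2.
have if_ : mu.-integrable `]0%R, +oo[ (EFin \o f).
  by have := @integrableD _ _ _ mu _ (measurable_itv `]0%R, +oo[) _ _ i1z ig2.
have E1 : \int[mu]_(t in `]0%R, +oo[) f t = 2 * C.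
  rewrite Rintegral_itv_obnd_cbnd//.
  rewrite (@Rintegral_ge0_continuous_FTC2y _ f F 0 0).
  - rewrite /F mulr0 expR0 /euler powR0 ?mul0r; [by ring|lra].
  - move=> t t0; rewrite /f addr_ge0//; last by rewrite subr_ge0 hC.
    by rewrite mulr_ge0// mulr_ge0 ?powR_ge0 ?expR_ge0.
  - have := @euler_continuous _ z10; have := @euler_continuous _ z0.
    move=> /continuous_within_itvcyP[c1 c1'] /continuous_within_itvcyP[c2 c2'].
    apply/continuous_within_itvcyP; split.
      move=> t t0; apply: cvgD; first by apply: cvgMl_tmp; exact: c2.
      by apply: cvgB; [exact: cg|exact: c1].
    apply: cvgD; first exact: cvgMl_tmp.
    by apply: cvgB => //; apply: cvg_at_right_filter; exact: cg.
  - rewrite -[X in _ --> X]addr0; apply: cvgD.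
      apply: (@squeeze_cvgr _ _ _ _ (fun=> 0) g); last 2 first.
      - exact: cvg_cst.
      - rewrite -[X in _ --> X](mulr0 C); apply: cvgMl_tmp.
        by apply: expR_cvg0y; rewrite oppr_lt0.
      near=> t; rewrite hC ?andbT; first by rewrite mulr_ge0 ?powR_ge0 ?expR_ge0.
      by near: t; exact: nbhs_pinfty_ge.
    rewrite -[X in _ --> X](mulr0 (- (2 * C))); apply: cvgMl_tmp.
    by apply: expR_cvg0y; rewrite oppr_lt0.
  - by move=> t t0; exact: (is_derive_derivable (dF t t0)).
  - apply: cvgD.
      by have /continuous_within_itvcyP[] := @euler_continuous _ z0.
    by apply: cvg_at_right_filter; exact: is_derive_continuous (dg 0).
  - move=> t; rewrite in_itv/= andbT => t0.
    by rewrite derive1E; exact: (is_derive_val (dF t t0)).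
have Eg : \int[mu]_(t in `]0%R, +oo[) g t = 2 * C.
  by rewrite /Rintegral /g expR_half_integral.
have G1 : \int[mu]_(t in `]0%R, +oo[) euler (z - 1) t = Gamma z by [].
have G2 : \int[mu]_(t in `]0%R, +oo[) euler z t = Gamma (z + 1).
  by rewrite /Gamma addrK.
have E2 : \int[mu]_(t in `]0%R, +oo[) f t =
    z * Gamma z + (2 * C - Gamma (z + 1)).
  rewrite RintegralD//; congr (_ + _); first by rewrite RintegralZl.
  by rewrite RintegralB// Eg G2.
move: E2; rewrite E1; clear; move: (Gamma z) (Gamma (z + 1)) => G G' ?; lra.
Unshelve. all: by end_near. Qed.

Lemma Gamma_gt0 (z : R) : 1 <= z -> 0 < Gamma z.
Proof.
move=> z1; have z10 : 0 <= z - 1 by lra.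
have ie := euler_integrable z10.
have E : (\int[mu]_(t in `]0%R, +oo[) (euler (z - 1) t)%:E = (Gamma z)%:E)%E.
  by rewrite /Gamma /Rintegral fineK//; exact: (integrable_fin_num _ ie).
rewrite -lte_fin -E.
have dF (t : R) : is_derive t 1 (fun t => - expR (- 1 * t)) (expR (- 1 * t)).
  have := is_deriveN (is_derive_expRM (- 1) t).
  by move=> /is_derive_eq; apply; ring.
have ce (t : R) : {for t, continuous (fun t => expR (- 1 * t))}.
  exact: is_derive_continuous (is_derive_expRM (- 1) t).
have E1 : (\int[mu]_(t in `[1%R, +oo[) (expR (- 1 * t))%:E = (expR (- 1))%:E)%E.
  rewrite (@ge0_continuous_FTC2y _ _ (fun t => - expR (- 1 * t)) _ 0).
  - by rewrite mulr1 EFinN oppeK add0e.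
  - by move=> t _; rewrite expR_ge0.
  - exact: continuous_subspaceT.
  - rewrite -oppr0; apply: cvgN; apply: expR_cvg0y; lra.
  - by move=> t _; exact: (is_derive_derivable (dF t)).
  - by apply: cvg_at_right_filter; exact: is_derive_continuous (dF 1).
  - by move=> t _; rewrite derive1E; exact: (is_derive_val (dF t)).
apply: (@lt_le_trans _ _ (expR (- 1))%:E); first by rewrite lte_fin expR_gt0.
have me : measurable_fun setT (EFin \o euler (z - 1)).
  apply/measurable_EFinP; apply: measurable_funM; first exact: measurable_powR.
  by apply: measurableT_comp => //; exact: measurable_oppr.
rewrite -E1; apply: (@le_trans _ _
    (\int[mu]_(t in `[1%R, +oo[) (euler (z - 1) t)%:E)%E).
  apply: ge0_le_integral => //.
  - by apply/measurable_EFinP/measurable_funTS; exact: continuous_measurable_fun.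
  - exact: measurable_funTS.
  - move=> t; rewrite /= in_itv/= andbT => t1; rewrite lee_fin mulN1r /euler.
    rewrite ler_peMl ?expR_ge0//.
    by rewrite -[X in X <= _](powRr0 t) ler_powR.
apply: ge0_subset_integral => //.
- exact: measurable_funTS.
- by move=> t _; rewrite lee_fin mulr_ge0 ?powR_ge0 ?expR_ge0.
- move=> t; rewrite /= !in_itv/= !andbT; lra.
Qed.

Lemma Gamma_shift (c : R) k : 1 <= c ->
  Gamma (k%:R + c) = Gamma c * \prod_(j < k) (j%:R + c).
Proof.
move=> c1; elim: k => [|k IH]; first by rewrite big_ord0 add0r mulr1.
rewrite big_ord_recr/= mulrA -IH -natr1 addrAC GammaS; first by rewrite mulrC.
by rewrite (le_trans c1)// lerDr.
Qed.

Lemma radial_coef_bessel (c : R) k : radial_coef c 0 1 k =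
  (-1) ^+ k / (k`!%:R * \prod_(j < k) (j%:R + c)).
Proof.
rewrite /radial_coef.
elim: k => [|k IH]; first by rewrite !big_ord0 expr0 fact0 mulr1 divr1.
rewrite big_ord_recr/= IH [in RHS]big_ord_recr/= exprS factS natrM !invfM.
by ring.
Qed.

(** The factor (x / 2)^(c - 1) / Gamma c is positive, so that the positive zeros
of J_(c - 1) are the square roots of four times the positive zeros of [radial c 0 1]. *)
Lemma bessel_J_radial (c x : R) : 1 <= c -> 0 < x ->
  bessel_J (c - 1) x =
  (x / 2) `^ (c - 1) / Gamma c * radial c 0 1 (x ^+ 2 / 4).
Proof.
move=> c1 x0; have c0 : 0 < c by lra.
have G0 : Gamma c != 0 by rewrite gt_eqF// Gamma_gt0.
apply: cvg_lim => //.
have a1 : `|0 * (x ^+ 2 / 4)| < 1 by rewrite mul0r normr0.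
apply: cvg_seriesMl (@radial_cvg _ c 0 1 _ c0 a1) => k /=.
have x2 : 0 < x / 2 by lra.
have -> : k%:R + (c - 1) + 1 = k%:R + c by ring.
rewrite Gamma_shift// radial_coef_bessel (powRD (r := k%:R *+ 2)); last first.
  by rewrite (gt_eqF x2) implybT.
have -> : (x / 2) `^ (k%:R *+ 2) = (x ^+ 2 / 4) ^+ k.
  rewrite -[k%:R *+ 2]mulr_natr -natrM powR_mulrn ?ltW// mulnC exprM; congr (_ ^+ k).
  by field.
field.
rewrite G0 pnatr_eq0 -lt0n fact_gt0 /=.
rewrite gt_eqF ?andbT//; apply: prodr_gt0 => j _; exact: ltr_wpDl.
Qed.

End GammaFunction.

(** * Small intervals *)

Section Asymptotics.
Context {R : realType}.

(** The parameter l is the one at which a zero of the solution enters the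
interval [0, t0], through its end t0. *)
Definition first_parameter (c t0 l : R) := [/\ 0 < l, radial c 1 l t0 = 0 &
  forall l', 0 <= l' < l -> forall t, 0 <= t <= t0 -> 0 < radial c 1 l' t].

Lemma leastE (A : set R) (m : R) : A m -> lbound A m -> least A = m.
Proof.
move=> Am lm; rewrite /least; case: xgetP => [x -> [Ax lx]|/(_ m)]; last by case.
by apply/eqP; rewrite eq_le lx// lm.
Qed.

Lemma first_positive_zero_bessel (c s1 : R) : 1 <= c -> 0 < s1 ->
  radial c 0 1 s1 = 0 -> (forall t, 0 <= t < s1 -> 0 < radial c 0 1 t) ->
  first_positive_zero (bessel_J (c - 1)) = 2 * Num.sqrt s1.
Proof.
move=> c1 s0 ys ypos; apply: leastE => /=.
  have x0 : 0 < 2 * Num.sqrt s1 by rewrite mulr_gt0// sqrtr_gt0.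
  split => //; rewrite bessel_J_radial// exprMn sqr_sqrtr ?ltW//.
  by rewrite (_ : 2 ^+ 2 * s1 / 4 = s1) ?ys ?mulr0//; field.
move=> x [/= x0]; rewrite bessel_J_radial// => /eqP.
have h : 0 < (x / 2) `^ (c - 1) / Gamma c.
  by rewrite divr_gt0 ?Gamma_gt0// powR_gt0//; lra.
rewrite mulf_eq0 (gt_eqF h)/=.
move=> /eqP yx; rewrite leNgt; apply/negP => xs.
have : 0 < radial c 0 1 (x ^+ 2 / 4).
  apply: ypos; apply/andP; split; first by rewrite divr_ge0// sqr_ge0.
  rewrite ltr_pdivrMr// -(sqr_sqrtr (ltW s0)).
  have := ltr_pM (ltW x0) (ltW x0) xs xs; rewrite !expr2; lra.
by rewrite yx ltxx.
Qed.

Lemma radial_a0 (c s : R) : radial c 0 s 1 = radial c 0 1 s.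
Proof. by rewrite [RHS]radial_scale mul0r mul1r. Qed.

(** The value of [radial c 1 (s / t)] at t tends to that of [radial c 0 1] at s,
which is negative for a suitable s. *)
Lemma first_parameter_exists (T : Type) (F : set_system T) (t : T -> R) (c : R) :
  Filter F -> 0 < c -> t @ F --> 0 -> (\forall x \near F, 0 < t x) ->
  \forall x \near F, exists l, first_parameter c (t x) l.
Proof.
move=> FF c0 t0 tpos.
have [s1 [s10 ys ypos yneg]] := radial_bessel_first_zero c0.
have [s /andP[ss1 _] yls] := yneg 1 ltr01.
have h : radial c (t x) s 1 @[x --> F] --> radial c 0 s 1.
  by apply: radial_continuous => //; [rewrite normr0|exact: cvg_cst].
have y0 : radial c 0 s 1 < 0 by rewrite radial_a0.
have h1 : \forall x \near F, radial c (t x) s 1 < 0 by exact: (cvgr_lt _ h).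
have h2 : \forall x \near F, t x < 1 by apply: (cvgr_lt _ t0).
near=> x.
have tx : 0 < t x by near: x.
have tx1 : t x < 1 by near: x.
have yx : radial c (t x) s 1 < 0 by near: x.
have [|||l [/andP[l0 _] yl lpos]] := @radial_first_parameter _ c (t x) (s / t x) c0.
- by rewrite tx.
- by apply/ltW/divr_gt0 => //; exact: lt_trans ss1.
- by rewrite radial_scale mul1r divfK ?gt_eqF//; exact: ltW.
by exists l; split.
Unshelve. all: by end_near. Qed.

(** Upper bound: for s slightly beyond s1, the solution with parameter s / t is
negative at t, so that the first parameter is at most s / t.  Lower bound: for
s in the compact interval [0, s1 - e] the limit is positive, hence, uniformly in
s, so is the solution for small t. *)
Lemma first_parameter_cvg (T : Type) (F : set_system T) (t l : T -> R) (c s1 : R) :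
  Filter F -> 0 < c -> t @ F --> 0 ->
  (\forall x \near F, 0 < t x) ->
  (\forall x \near F, first_parameter c (t x) (l x)) ->
  0 < s1 -> (forall s, 0 <= s < s1 -> 0 < radial c 0 1 s) ->
  (forall d, 0 < d -> exists2 s, s1 < s < s1 + d & radial c 0 1 s < 0) ->
  l x * t x @[x --> F] --> s1.
Proof.
move=> FF c0 t0 tpos lP s10 ypos yneg.
apply/cvgrPdist_le => e e0.
have [s /andP[ss1 se] yls] := yneg e e0.
have h1 : \forall x \near F, radial c (t x) s 1 < 0.
  have h : radial c (t x) s 1 @[x --> F] --> radial c 0 s 1.
    by apply: radial_continuous => //; [rewrite normr0|exact: cvg_cst].
  by apply: (cvgr_lt _ h); rewrite radial_a0.
have h2 : \forall x \near F, `[0, s1 - e]%classic `<=`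
    (fun s' => 0 < radial c (t x) s' 1).
  have /compact_near_coveringP := @segment_compact R 0 (s1 - e).
  apply => // s' /=; rewrite in_itv/= => /andP[s'0 s'e].
  have h : radial c (t p.2) p.1 1 @[p --> (nbhs s', F)] --> radial c 0 s' 1.
    apply: radial_continuous => //; first by rewrite normr0.
      by apply: cvg_comp t0; exact: cvg_snd.
    exact: cvg_fst.
  have y0 : 0 < radial c 0 s' 1 by rewrite radial_a0; apply: ypos; rewrite s'0/=; lra.
  exact: (cvgr_gt _ h _ y0).
near=> x.
have tx : 0 < t x by near: x.
have [lx yl lpos] : first_parameter c (t x) (l x) by near: x.
have yx : radial c (t x) s 1 < 0 by near: x.
have ylow : `[0, s1 - e]%classic `<=` (fun s' => 0 < radial c (t x) s' 1) by near: x.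
have up : l x * t x <= s.
  rewrite leNgt; apply/negP => sl.
  have : 0 < radial c 1 (s / t x) (t x).
    apply: lpos; last by rewrite lexx (ltW tx).
    rewrite ltr_pdivrMr// sl andbT.
    by apply/ltW/divr_gt0 => //; exact: lt_trans ss1.
  by rewrite radial_scale mul1r divfK ?gt_eqF// ltNge (ltW yx).
have low : s1 - e < l x * t x.
  rewrite ltNge; apply/negP => sl.
  have lt0 : 0 <= l x * t x by apply/mulr_ge0; exact: ltW.
  have := ylow (l x * t x); rewrite /= in_itv/= lt0 => /(_ sl).
  by move: yl; rewrite radial_scale mul1r => ->; rewrite ltxx.
by rewrite ler_norml; apply/andP; split; lra.
Unshelve. all: by end_near. Qed.

End Asymptotics.

(** * Calculus along lines *)

Section DirectionalDerivative.
Context {R : realType} {V : normedModType R}.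
Implicit Types (f z : V -> R) (x v : V).

(** Directional derivatives are derivatives of the restriction to a line, which
reduces the multivariate computations to one variable. *)
Lemma is_derive_lineP f x v (df : R) :
  is_derive x v f df <-> is_derive (0 : R) 1 (fun h : R => f (h *: v + x)) df.
Proof.
have E : (fun h : R => h^-1 *: ((f \o shift x) (h *: v) - f x)) =
  (fun h : R => h^-1 *: (((fun k : R => f (k *: v + x)) \o shift 0) (h *: 1)
     - f (0 *: v + x))).
  by apply/funext => h /=; rewrite addr0 scale0r add0r [_%:A]mulr1.
split=> -[d1 d2]; apply: DeriveDef.
- by move: d1; rewrite /derivable E.
- by move: d2; rewrite /derive E.
- by rewrite /derivable E.
- by rewrite /derive E.
Qed.

Lemma is_derive_line f x v (s df : R) :
  is_derive (s *: v + x) v f df ->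
  is_derive s 1 (fun h : R => f (h *: v + x)) df.
Proof.
move=> /is_derive_lineP h.
have -> : (fun h : R => f (h *: v + x)) =
  (fun h : R => f (h *: v + (s *: v + x))) \o (fun t => t - s).
  by apply/funext => t /=; rewrite addrA -scalerDl subrK.
have hs : is_derive s 1 (fun t : R => t - s) 1.
  by apply: is_derive_eq; rewrite subr0.
rewrite -[df]mulr1; apply: is_derive1_comp.
by rewrite subrr.
Qed.

Lemma is_derive_chain (phi : R -> R) z x v (dphi dz : R) :
  is_derive (z x) 1 phi dphi -> is_derive x v z dz ->
  is_derive x v (fun y => phi (z y)) (dphi * dz).
Proof.
move=> hphi /is_derive_lineP hz; apply/is_derive_lineP.
apply: (@is_derive1_comp _ phi (fun h : R => z (h *: v + x))) => //.
by rewrite scale0r add0r.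
Qed.

Lemma line_cvg x v : h *: v + x @[h --> (0 : R)] --> x.
Proof.
have : h *: v + x @[h --> (0 : R)] --> 0 *: v + x.
  by apply: cvgD; [apply: cvgZr_tmp; exact: cvg_id|exact: cvg_cst].
by rewrite scale0r add0r.
Qed.

(** The first derivative vanishes at the maximum; if the second one were
positive, the first would be positive just after, and the function would
increase along the line. *)
Lemma derive2_at_max f x v (a : R) :
  (\forall y \near x, derivable f y v) ->
  is_derive x v ('D_v f) a -> (\forall y \near x, f y <= f x) -> a <= 0.
Proof.
move=> fd fdd fmax; rewrite leNgt; apply/negP => a0.
have hs : \forall y \near x, derivable f y v /\ f y <= f x.
  by apply: filterS2 fd fmax => y; split.
have [e /= e0 he] := @line_cvg x v _ hs.
have ball0 (h : R) : - e < h < e -> ball_ Num.norm 0 e h.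
  by rewrite /ball_/= sub0r normrN ltr_norml.
pose g (h : R) := f (h *: v + x).
have dg (h : R) : - e < h < e -> is_derive h 1 g ('D_v f (h *: v + x)).
  move=> /ball0 /he[d _]; apply: is_derive_line; exact: derivableP.
have g0 : g 0 = f x by rewrite /g scale0r add0r.
have Dx0 : 'D_v f x = 0.
  have H : is_derive (0 : R) 1 g 0.
    apply: (@derive1_at_max _ g (- e) e).
    - lra.
    - move=> t; rewrite in_itv/= => /dg h.
      exact: (is_derive_derivable h).
    - by rewrite in_itv/=; apply/andP; split; lra.
    - by move=> t; rewrite in_itv/= => /ball0 /he[_]; rewrite g0.
  have : - e < 0 < e by apply/andP; split; lra.
  move=> /dg; rewrite scale0r add0r => h.
  by rewrite -(is_derive_val h) (is_derive_val H).
have := is_derive_derivable fdd; rewrite /derivable => /cvg_ex[l hl].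
have la : l = a.
  by rewrite -(is_derive_val fdd) /derive; apply/esym/cvg_lim.
rewrite {}la in hl.
have [e' /= e'0 he'] := cvgr_gt _ hl _ a0.
pose m := Num.min e e' / 2.
have m1 : Num.min e e' <= e by rewrite ge_min lexx.
have m2 : Num.min e e' <= e' by rewrite ge_min lexx orbT.
have m0 : 0 < Num.min e e' by rewrite lt_min e0.
have mp : 0 < m by rewrite /m; lra.
have [h' /andP[h0 hm] E] : exists2 h, 0 < h < m & g m - g 0 = 'D_v f (h *: v + x) * (m - 0).
  apply: (@MVT_is_derive _ g (fun h => 'D_v f (h *: v + x))) => // h /andP[h0 hm].
  by apply: dg; rewrite /m in hm; apply/andP; split; lra.
have Dpos : 0 < 'D_v f (h' *: v + x).
  have := he' h'; rewrite /ball_/= sub0r normrN gtr0_norm// => H.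
  have : h' < e' by rewrite /m in hm; lra.
  move=> /H; rewrite gt_eqF// => /(_ isT); rewrite Dx0 subr0.
  by rewrite /GRing.scale/= pmulr_rgt0// invr_gt0.
have : g m <= g 0.
  have : - e < m < e by rewrite /m; apply/andP; split; lra.
  by move=> /ball0/he[_]; rewrite g0.
have : 0 < g m - g 0 by rewrite E subr0 mulr_gt0.
lra.
Qed.

End DirectionalDerivative.

(** * Zonal functions on Euclidean space *)

Section PointwiseContinuity.
Context {R : realType} {T : topologicalType}.
Implicit Types (f g : T -> R) (x : T).

Lemma contD f g x : {for x, continuous f} -> {for x, continuous g} ->
  {for x, continuous (fun y => f y + g y)}.
Proof. exact: continuousD. Qed.

Lemma contB f g x : {for x, continuous f} -> {for x, continuous g} ->
  {for x, continuous (fun y => f y - g y)}.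
Proof. exact: continuousB. Qed.

Lemma contM f g x : {for x, continuous f} -> {for x, continuous g} ->
  {for x, continuous (fun y => f y * g y)}.
Proof. exact: continuousM. Qed.

Lemma contX f k x : {for x, continuous f} -> {for x, continuous (fun y => f y ^+ k)}.
Proof.
move=> fx; elim: k => [|k IH]; first exact: cst_continuous.
have -> : (fun y => f y ^+ k.+1) = (fun y => f y * f y ^+ k).
  by apply/funext => y; rewrite exprS.
exact: contM.
Qed.

End PointwiseContinuity.

Section EuclideanNorm.
Context {R : realType} {n : nat}.
Implicit Types (x : 'rV[R]_n.+1) (i j : 'I_n.+1).
Local Notation e_ i := (delta_mx (0 : 'I_1) i : 'rV[R]_n.+1).
Local Notation N := (@ord_max n).

Definition kron i j : R := (i == j)%:R.

Lemma enorm_ge0 x : 0 <= enorm x. Proof. exact: sqrtr_ge0. Qed.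

Lemma sqr_enorm x : enorm x ^+ 2 = \sum_i x 0 i ^+ 2.
Proof. by rewrite sqr_sqrtr// sumr_ge0// => i _; exact: sqr_ge0. Qed.

Lemma coord_le_enorm x i : `|x 0 i| <= enorm x.
Proof.
rewrite -(@ler_pXn2r _ 2) ?nnegrE ?enorm_ge0//.
rewrite sqr_enorm real_normK ?num_real// (bigD1 i)//= lerDl.
by apply: sumr_ge0 => j _; exact: sqr_ge0.
Qed.

Lemma enorm_gt0 x : (0 < enorm x) = (x != 0).
Proof.
rewrite lt_neqAle enorm_ge0 andbT eq_sym; congr (~~ _).
apply/eqP/eqP => [x0|->]; last first.
  by rewrite /enorm big1 ?sqrtr0// => i _; rewrite mxE expr0n.
apply/rowP => i; rewrite mxE; apply/eqP.
by rewrite -normr_eq0 eq_le normr_ge0 andbT -x0 coord_le_enorm.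
Qed.

Lemma enormZ (k : R) x : 0 <= k -> enorm (k *: x) = k * enorm x.
Proof.
move=> k0; rewrite /enorm.
have -> : \sum_i (k *: x) 0 i ^+ 2 = k ^+ 2 * \sum_i x 0 i ^+ 2.
  by rewrite mulr_sumr; apply: eq_bigr => i _; rewrite mxE exprMn.
by rewrite sqrtrM ?sqr_ge0// sqrtr_sqr ger0_norm.
Qed.

Lemma enorm_continuous x : {for x, continuous (@enorm R n)}.
Proof.
apply: continuous_comp; last exact: sqrt_continuous.
rewrite /continuous_at.
have H (s : seq 'I_n.+1) :
    {for x, continuous (fun y : 'rV[R]_n.+1 => \sum_(i <- s) y 0 i ^+ 2)}.
  elim: s => [|i s IH].
    have -> : (fun y : 'rV[R]_n.+1 => \sum_(i <- [::]) y 0 i ^+ 2) = cst 0.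
      by apply/funext => y; rewrite big_nil.
    exact: cst_continuous.
  have -> : (fun y : 'rV[R]_n.+1 => \sum_(i <- i :: s) y 0 i ^+ 2) =
      (fun y => y 0 i ^+ 2 + \sum_(i <- s) y 0 i ^+ 2).
    by apply/funext => y; rewrite big_cons.
  by apply: contD => //; apply: contX; exact: coord_continuous.
exact: H.
Qed.

Lemma is_derive_coord x i j : is_derive x (e_ i) (fun y => y 0 j) (kron j i).
Proof.
apply/is_derive_lineP.
have -> : (fun h : R => (h *: e_ i + x) 0 j) = (fun h => h * kron j i + x 0 j).
  by apply/funext => h; rewrite !mxE eqxx.
have h : is_derive (0 : R) 1 (fun h : R => h * kron j i) (kron j i).
  by apply: is_derive_eq; rewrite /GRing.scale/= mulr0 mulr1 add0r.
have := is_deriveD h (is_derive_cst (x 0 j) (0 : R) (1 : R)).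
by move=> /is_derive_eq; apply; rewrite addr0.
Qed.

Definition rnorm x : R := (enorm x)^-1.

Lemma rnorm_continuous x : x != 0 -> {for x, continuous rnorm}.
Proof.
move=> x0; apply: continuousV; first by rewrite gt_eqF// enorm_gt0.
exact: enorm_continuous.
Qed.

Lemma is_derive_rnorm x i : x != 0 ->
  is_derive x (e_ i) rnorm (- x 0 i * rnorm x ^+ 3).
Proof.
move=> x0; have ex : 0 < enorm x by rewrite enorm_gt0.
have s0 : 0 < \sum_i x 0 i ^+ 2 by rewrite -sqr_enorm exprn_gt0.
have h1 : is_derive x (e_ i) (fun y => \sum_j y 0 j ^+ 2) (2 * x 0 i).
  have := @is_derive_sum _ _ _ _ (fun j (y : 'rV[R]_n.+1) => y 0 j ^+ 2) x (e_ i)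
    (fun j => 2 * x 0 j * kron j i).
  have -> : \sum_(j < n.+1) (fun y : 'rV[R]_n.+1 => y 0 j ^+ 2) =
      (fun y => \sum_j y 0 j ^+ 2) by apply/funext => y; rewrite fct_sumE.
  move=> /(_ _)/is_derive_eq; apply.
    move=> j; have := is_deriveX 2 (is_derive_coord x i j).
    by move=> /is_derive_eq; apply; rewrite /GRing.scale/= expr1.
  rewrite (bigD1 i)//= /kron eqxx mulr1 big1 ?addr0// => j ji.
  by rewrite (negbTE ji) mulr0.
have h2 := is_derive_chain (is_derive1_sqrt s0) h1.
have en : enorm x != 0 by rewrite gt_eqF.
have hV : is_derive (enorm x) 1 (fun y : R => y^-1) (- enorm x ^- 2 *: 1).
  exact: is_deriveV.
have := @is_derive_chain _ _ (fun y : R => y^-1) (@enorm R n) x (e_ i) _ _ hV h2.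
move=> /is_derive_eq; apply.
rewrite /GRing.scale/= mulr1 -/(enorm x) /rnorm.
by field.
Qed.

(** The last coordinate of the radial projection of x on the sphere, that is,
the 0-homogeneous extension of the height x_N; [height1] and [height2] are its
partial derivatives of order one and two. *)
Definition height x : R := rnorm x * x 0 N.

Definition height1 i x : R := kron N i * rnorm x - x 0 N * x 0 i * rnorm x ^+ 3.

Definition height2 i j x : R :=
  3 * x 0 N * x 0 i * x 0 j * rnorm x ^+ 5
  - (kron N i * x 0 j + kron N j * x 0 i + x 0 N * kron i j) * rnorm x ^+ 3.

Lemma height_le1 x : height x <= 1.
Proof.
rewrite /height /rnorm; have [->|x0] := eqVneq x 0.
  by rewrite mxE mulr0.
rewrite mulrC ler_pdivrMr ?enorm_gt0// mul1r.
exact: le_trans (ler_norm _) (coord_le_enorm _ _).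
Qed.

Lemma height_continuous x : x != 0 -> {for x, continuous height}.
Proof.
by move=> x0; apply: contM; [exact: rnorm_continuous|exact: coord_continuous].
Qed.

Lemma height1_continuous i x : x != 0 -> {for x, continuous (height1 i)}.
Proof.
move=> x0; have r := rnorm_continuous x0.
apply: contB; first by apply: contM => //; exact: cst_continuous.
by apply: contM; [apply: contM; exact: coord_continuous|exact: contX].
Qed.

Lemma height2_continuous i j x : x != 0 -> {for x, continuous (height2 i j)}.
Proof.
move=> x0; have r := rnorm_continuous x0.
have c k := @coord_continuous R _ _ (0 : 'I_1) (k : 'I_n.+1) x.
have k (a : R) := @cst_continuous 'rV[R]_n.+1 R a x.
apply: contB; apply: contM; try exact: contX.
  by apply: contM; [apply: contM; [apply: contM; [exact: k|exact: c]|exact: c]|exact: c].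
apply: contD; first by apply: contD; apply: contM; [exact: k|exact: c|exact: k|exact: c].
by apply: contM; [exact: c|exact: k].
Qed.

Lemma is_derive_height i x : x != 0 -> is_derive x (e_ i) height (height1 i x).
Proof.
move=> x0; have := is_deriveM (is_derive_rnorm i x0) (is_derive_coord x i N).
by move=> /is_derive_eq; apply; rewrite /height1 /GRing.scale/=; ring.
Qed.

Lemma is_derive_height1 i j x : x != 0 ->
  is_derive x (e_ j) (height1 i) (height2 i j x).
Proof.
move=> x0; have dr := is_derive_rnorm j x0.
have dN := is_derive_coord x j N; have di := is_derive_coord x j i.
have d1 := is_deriveMl (kron N i) dr.
have d2 := is_deriveM (is_deriveM dN di) (is_deriveX 3 dr).
have := is_deriveB d1 d2.
move=> /is_derive_eq; apply.
by rewrite /height2 /GRing.scale !fctE/=; ring.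
Qed.

(** The interval ]-1, 3[ for the height is the one on which t = (1 - height) / 2
satisfies |t| < 1; it is open and contains the height 1 of the pole. *)
Section Zonal.
Variables (phi phi1 phi2 : R -> R).
Hypothesis dphi : forall z : R, -1 < z < 3 -> is_derive z 1 phi (phi1 z).
Hypothesis dphi1 : forall z : R, -1 < z < 3 -> is_derive z 1 phi1 (phi2 z).
Hypothesis cphi2 : forall z : R, -1 < z < 3 -> {for z, continuous phi2}.

Let A := [set x : 'rV[R]_n.+1 | x != 0 /\ -1 < height x < 3].

Lemma zonal_dom_open x : A x -> \forall y \near x, A y.
Proof.
move=> [x0 /andP[h1 h2]].
have hc := height_continuous x0.
have hn : \forall y \near x, 0 < enorm y.
  by apply: (cvgr_gt _ (@enorm_continuous x)); rewrite enorm_gt0.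
have H1 : \forall y \near x, -1 < height y by apply: (cvgr_gt _ hc).
have H2 : \forall y \near x, height y < 3 by apply: (cvgr_lt _ hc).
near=> y; split; first by rewrite -enorm_gt0; near: y.
by apply/andP; split; near: y.
Unshelve. all: by end_near. Qed.

Definition zonal1 i x : R := phi1 (height x) * height1 i x.
Definition zonal2 i j x : R :=
  phi2 (height x) * height1 j x * height1 i x + phi1 (height x) * height2 i j x.

Lemma is_derive_zonal i x : A x ->
  is_derive x (e_ i) (fun y => phi (height y)) (zonal1 i x).
Proof.
move=> [x0 hx].
exact: is_derive_chain (dphi hx) (is_derive_height i x0).
Qed.

Lemma is_derive_zonal1 i j x : A x ->
  is_derive x (e_ j) (zonal1 i) (zonal2 i j x).
Proof.
move=> [x0 hx].
have h1 := is_derive_chain (dphi1 hx) (is_derive_height j x0).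
have := is_deriveM h1 (is_derive_height1 i j x0).
move=> /is_derive_eq; apply.
by rewrite /zonal2 /GRing.scale/=; ring.
Qed.

Lemma partial_zonal i x : A x ->
  \forall y \near x, zonal1 i y = partial i (fun y => phi (height y)) y.
Proof.
move=> /zonal_dom_open; apply: filterS => y Ay.
by rewrite /partial (is_derive_val (is_derive_zonal i Ay)).
Qed.

Lemma is_derive_partial_zonal i j x : A x ->
  is_derive x (e_ j) (partial i (fun y => phi (height y))) (zonal2 i j x).
Proof.
move=> Ax; apply: near_eq_is_derive (partial_zonal i Ax) _.
exact: is_derive_zonal1.
Qed.

Lemma comp_height_continuous (psi : R -> R) x : x != 0 ->
  {for height x, continuous psi} -> {for x, continuous (fun y => psi (height y))}.
Proof.
by move=> x0 cpsi; apply: continuous_comp => //; exact: height_continuous.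
Qed.

Lemma near_eq_continuous (f g : 'rV[R]_n.+1 -> R) x :
  (\forall y \near x, f y = g y) -> {for x, continuous f} -> {for x, continuous g}.
Proof.
move=> fg cf; rewrite /prop_for /continuous_at -(nbhs_singleton fg).
exact: cvg_trans (near_eq_cvg fg) cf.
Qed.

Lemma zonal_C2 (B : set 'rV[R]_n.+1) : B `<=` A ->
  C2_on B (fun y => phi (height y)).
Proof.
move=> BA x /BA Ax; have [x0 hx] := Ax.
have c0 := is_derive_continuous (dphi hx).
have c1 := is_derive_continuous (dphi1 hx).
have c2 := cphi2 hx.
split.
- exact: comp_height_continuous.
- by move=> i; exact: (is_derive_derivable (is_derive_zonal i Ax)).
- move=> i; apply: near_eq_continuous (partial_zonal i Ax) _.
  by apply: contM; [exact: comp_height_continuous|exact: height1_continuous].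
- by move=> i j; exact: (is_derive_derivable (is_derive_partial_zonal i j Ax)).
- move=> i j.
  apply: (@near_eq_continuous (zonal2 i j)).
    move: Ax => /zonal_dom_open; apply: filterS => y Ay.
    by rewrite /partial (is_derive_val (is_derive_partial_zonal i j Ay)).
  apply: contD.
    apply: contM; last exact: height1_continuous.
    by apply: contM; [exact: comp_height_continuous|exact: height1_continuous].
  by apply: contM; [exact: comp_height_continuous|exact: height2_continuous].
Qed.

(** On the unit sphere the gradient of the height has squared length
1 - x_N^2 and its Laplacian is - n x_N. *)
Lemma laplacian_zonal x : A x -> enorm x = 1 ->
  laplacian (fun y => phi (height y)) x =
  (1 - x 0 N ^+ 2) * phi2 (x 0 N) - n%:R * x 0 N * phi1 (x 0 N).
Proof.
move=> Ax x1; have [x0 _] := Ax.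
have r1 : rnorm x = 1 by rewrite /rnorm x1 invr1.
have hN : height x = x 0 N by rewrite /height r1 mul1r.
have S : \sum_i x 0 i ^+ 2 = 1 by rewrite -sqr_enorm x1 expr1n.
have K (a : 'I_n.+1 -> R) : \sum_i kron N i * a i = a N.
  rewrite (bigD1 N)//= /kron eqxx mul1r big1 ?addr0// => i iN.
  by rewrite eq_sym (negbTE iN) mul0r.
have E i : partial i (partial i (fun y => phi (height y))) x =
  phi2 (x 0 N) * (kron N i * (1 - 2 * x 0 N * x 0 i) + x 0 N ^+ 2 * x 0 i ^+ 2)
  + phi1 (x 0 N) * (3 * x 0 N * x 0 i ^+ 2 - kron N i * (2 * x 0 i) - x 0 N).
  rewrite /partial (is_derive_val (is_derive_partial_zonal i i Ax)).
  rewrite /zonal2 hN /height1 /height2 r1 !expr1n.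
  have -> : kron i i = 1 by rewrite /kron eqxx.
  have kk : kron N i * kron N i = kron N i.
    by rewrite /kron; case: eqP; rewrite ?mulr1 ?mulr0.
  transitivity (phi2 (x 0 N) * (kron N i * kron N i
      - kron N i * (2 * x 0 N * x 0 i) + x 0 N ^+ 2 * x 0 i ^+ 2)
    + phi1 (x 0 N) * (3 * x 0 N * x 0 i ^+ 2 - kron N i * (2 * x 0 i) - x 0 N)).
    by ring.
  by rewrite kk; ring.
rewrite /laplacian (eq_bigr _ (fun i _ => E i)) big_split/= -!mulr_sumr.
rewrite !big_split/= !sumrN K -mulr_sumr S K -mulr_sumr S sumr_const card_ord.
rewrite -mulr_natr -natr1.
by ring.
Qed.

End Zonal.

End EuclideanNorm.

(** * The first Dirichlet eigenvalue of a cap *)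

Section Cap.
Context {R : realType} {n : nat}.
Implicit Types (x : 'rV[R]_n.+1) (g : R).
Local Notation N := (@ord_max n).
Local Notation capg := (@cap R n).
Local Notation coneg := (@cone R n).

Lemma cos_gtN1 g : 0 < g < pi -> -1 < cos g < 1.
Proof.
move=> /andP[g0 gpi].
have s0 : 0 < sin g by apply: sin_gt0_pi; rewrite g0.
have := sin2cos2 g; have : 0 < sin g ^+ 2 by rewrite exprn_gt0.
move: (cos g) => k; rewrite !expr2 => ? ?; apply/andP; split; nra.
Qed.

Lemma coneE g x : coneg g x -> x != 0 /\ cos g < height x.
Proof.
move=> [x0 gx]; split => //; rewrite /height /rnorm mulrC.
by rewrite ltr_pdivlMr ?enorm_gt0// mulrC.
Qed.

Lemma cone_open g x : coneg g x -> \forall y \near x, coneg g y.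
Proof.
move=> cx; have [x0 hx] := coneE cx.
have H1 : \forall y \near x, 0 < enorm y.
  by apply: (cvgr_gt _ (@enorm_continuous R n x)); rewrite enorm_gt0.
have H2 : \forall y \near x, cos g < height y.
  by apply: (cvgr_gt _ (height_continuous x0)).
apply: filterS2 H1 H2 => y y0 hy; split; first by rewrite -enorm_gt0.
by rewrite -ltr_pdivlMl//.
Qed.

Lemma cone_scale g x : coneg g x -> capg g (rnorm x *: x).
Proof.
move=> cx; have [x0 hx] := coneE cx.
have e0 : 0 < enorm x by rewrite enorm_gt0.
have e1 : enorm (rnorm x *: x) = 1.
  by rewrite enormZ ?invr_ge0 ?enorm_ge0// /rnorm mulVf// gt_eqF.
split; last exact: e1.
by split; [rewrite -enorm_gt0 e1|rewrite e1 mul1r mxE].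
Qed.

Lemma closure_capP g x : closure (capg g) x -> enorm x = 1 /\ cos g <= x 0 N.
Proof.
have c1 : closed [set y : 'rV[R]_n.+1 | enorm y = 1].
  have -> : [set y : 'rV[R]_n.+1 | enorm y = 1] = @enorm R n @^-1` [set 1] by [].
  by apply: preimage_closed; [move=> y _; exact: enorm_continuous|exact: closed_eq].
have c2 : closed [set y : 'rV[R]_n.+1 | cos g <= y 0 N].
  have -> : [set y : 'rV[R]_n.+1 | cos g <= y 0 N] =
     (fun y : 'rV[R]_n.+1 => y 0 N) @^-1` [set t | cos g <= t] by [].
  by apply: preimage_closed; [move=> y _; exact: coord_continuous|exact: closed_ge].
have h : capg g `<=` [set y | enorm y = 1] `&` [set y | cos g <= y 0 N].
  by move=> y [[_ gy] /= y1]; split => //=; rewrite y1 mul1r in gy; exact: ltW.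
move=> cx; have := closure_subset h cx.
have /closure_id <- : closed ([set y : 'rV[R]_n.+1 | enorm y = 1]
   `&` [set y | cos g <= y 0 N]) by exact: closedI.
by case.
Qed.

Lemma compact_closure_cap g : compact (closure (capg g)).
Proof.
apply: bounded_closed_compact; last exact: closed_closure.
exists 1; split => // M M1 x /closure_capP[x1 _].
apply: le_trans (ltW M1).
rewrite [leLHS]mx_normrE; apply/bigmax_leP; split => // -[i j] _ /=.
by rewrite ord1 -x1; exact: coord_le_enorm.
Qed.

Lemma cap_in_closure g x : capg g x -> closure (capg g) x.
Proof. exact: subset_closure. Qed.

Lemma cap_boundary g x : (closure (capg g) `\` capg g) x -> x 0 N = cos g.
Proof.
move=> [cx ncx]; have [x1 gx] := closure_capP cx.
apply/eqP; rewrite eq_le gx andbT leNgt; apply/negP => gx'.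
apply: ncx; split; last exact: x1.
by split; [rewrite -enorm_gt0 x1|rewrite x1 mul1r].
Qed.

Lemma hom0ext_sphere (u : 'rV[R]_n.+1 -> R) x : enorm x = 1 -> hom0ext u x = u x.
Proof. by rewrite /hom0ext => ->; rewrite invr1 scale1r. Qed.

(** Barta's comparison.  Let eps be the sign of u at a point where u is nonzero,
and M > 0 the maximum of eps * u / w over the closed cap.  It is attained inside
the cap, and at this point eps * u - M * w has a maximum with value 0, so that its
Laplacian, M * w * (lam - mu), is nonpositive.  Positivity of w up to the boundary
is what makes the quotient continuous on the closed cap. *)
Lemma eigenvalue_ge g (mu lam : R) (u w : 'rV[R]_n.+1 -> R) :
  dirichlet_eigenfunction g mu u ->
  C2_on (cone g) (hom0ext w) -> {within closure (cap g), continuous w} ->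
  (forall x, closure (cap g) x -> 0 < w x) ->
  (forall x, cap g x -> - laplace_beltrami w x = lam * w x) ->
  lam <= mu.
Proof.
move=> [uC2 uc u0 uL [x1 [cx1 ux1]]] wC2 wc wpos wL.
pose eps : R := Num.sg (u x1).
pose q x := eps * u x / w x.
have qx1 : 0 < q x1.
  rewrite /q divr_gt0 ?wpos//; last exact: cap_in_closure.
  by rewrite /eps -normrEsg normr_gt0.
have qc : {within closure (cap g), continuous q}.
  apply/subspace_continuousP => x cx.
  have /subspace_continuousP/(_ x cx) ux := uc.
  have /subspace_continuousP/(_ x cx) wx := wc.
  apply: cvgM; first exact: cvgMl_tmp.
  by apply: cvgV => //; rewrite gt_eqF// wpos.
have [x0 /set_mem cx0 qmax] : exists2 x0, x0 \in closure (cap g) &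
    forall x, x \in closure (cap g) -> q x <= q x0.
  apply: compact_EVT_max => //; last exact: compact_closure_cap.
  by exists x1; exact: cap_in_closure.
pose M := q x0.
have M0 : 0 < M.
  by apply: lt_le_trans qx1 _; apply: qmax; apply/mem_set; exact: cap_in_closure.
have cap0 : cap g x0.
  apply: contrapT => nc; move: M0; rewrite /M /q u0; last by split.
  by rewrite mulr0 mul0r ltxx.
have [cone0 e0] := cap0.
pose U := hom0ext u; pose W := hom0ext w.
pose f x := eps * U x - M * W x.
have fle x : cone g x -> f x <= 0.
  move=> /cone_scale cx; rewrite /f /U /W /hom0ext.
  have ccx := cap_in_closure cx.
  have := qmax _ (mem_set ccx); rewrite -/M /q ler_pdivrMr ?wpos//.
  by rewrite subr_le0.
have f0 : f x0 = 0.
  rewrite /f /U /W !hom0ext_sphere// /M /q divfK ?subrr//.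
  by rewrite gt_eqF// wpos.
have near0 := cone_open cone0.
have dd (i : 'I_n.+1) :
    eps * partial i (partial i U) x0 - M * partial i (partial i W) x0 <= 0.
  have d1 x : cone g x ->
      is_derive x (delta_mx 0 i) f (eps * partial i U x - M * partial i W x).
    move=> cx; have [_ dU _ _ _] := uC2 _ cx; have [_ dW _ _ _] := wC2 _ cx.
    apply: is_deriveB.
      exact: (is_deriveMl eps (derivableP (dU i))).
    exact: (is_deriveMl M (derivableP (dW i))).
  have d2 : is_derive x0 (delta_mx 0 i)
      (fun x => eps * partial i U x - M * partial i W x)
      (eps * partial i (partial i U) x0 - M * partial i (partial i W) x0).
    have [_ _ _ ddU _] := uC2 _ cone0; have [_ _ _ ddW _] := wC2 _ cone0.
    apply: is_deriveB.
      exact: (is_deriveMl eps (derivableP (ddU i i))).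
    exact: (is_deriveMl M (derivableP (ddW i i))).
  apply: (@derive2_at_max _ _ f x0 (delta_mx 0 i)).
  - apply: filterS near0 => y cy.
    exact: (is_derive_derivable (d1 y cy)).
  - apply: near_eq_is_derive d2; apply: filterS near0 => y cy.
    by rewrite (is_derive_val (d1 y cy)).
  - by apply: filterS near0 => y cy; rewrite f0; exact: fle.
have : eps * laplace_beltrami u x0 - M * laplace_beltrami w x0 <= 0.
  rewrite /laplace_beltrami /laplacian !mulr_sumr -sumrB.
  by apply: sumr_le0 => i _; exact: dd.
have := uL _ cap0; have := wL _ cap0.
have EM : eps * u x0 = M * w x0.
  by rewrite /M /q divfK// gt_eqF// wpos.
move=> /eqP; rewrite eqr_oppLR => /eqP -> /eqP; rewrite eqr_oppLR => /eqP ->.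
have -> : eps * - (mu * u x0) - M * - (lam * w x0) = M * w x0 * (lam - mu).
  transitivity (- mu * (eps * u x0) + M * lam * w x0); first by ring.
  by rewrite EM; ring.
rewrite pmulr_rle0 ?subr_le0//.
by rewrite mulr_gt0// wpos.
Qed.

Definition zonal (l : R) x : R := radial (n%:R / 2) 1 l ((1 - x 0 N) / 2).

Hypothesis n2 : (2 <= n)%N.
Let c : R := n%:R / 2.

Let c0 : 0 < c.
Proof. by rewrite divr_gt0// ltr0n (leq_trans _ n2). Qed.

Let phi (l z : R) := radial c 1 l ((1 - z) / 2).
Let phi1 (l z : R) := - (1 / 2) * radial1 c 1 l ((1 - z) / 2).
Let phi2 (l z : R) := 1 / 4 * radial2 c 1 l ((1 - z) / 2).

Let half_bound (z : R) : -1 < z < 3 -> `|1 * ((1 - z) / 2)| < 1.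
Proof. by move=> /andP[? ?]; rewrite mul1r ltr_norml; apply/andP; split; lra. Qed.

Let dhalf (z : R) : is_derive z 1 (fun z : R => (1 - z) / 2) (- (1 / 2)).
Proof. by apply: is_derive_eq; rewrite /GRing.scale/=; field. Qed.

Let dphi l (z : R) : -1 < z < 3 -> is_derive z 1 (phi l) (phi1 l z).
Proof.
move=> /half_bound hz.
have := @is_derive1_comp _ (radial c 1 l) (fun z : R => (1 - z) / 2) z _ _
  (radial_is_derive l c0 hz) (dhalf z).
by move=> /is_derive_eq; apply; rewrite /phi1 mulrC.
Qed.

Let dphi1 l (z : R) : -1 < z < 3 -> is_derive z 1 (phi1 l) (phi2 l z).
Proof.
move=> /half_bound hz.
have := @is_derive1_comp _ (radial1 c 1 l) (fun z : R => (1 - z) / 2) z _ _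
  (radial1_is_derive l c0 hz) (dhalf z).
move=> h; have := is_deriveMl (- (1 / 2)) h.
by move=> /is_derive_eq; apply; rewrite /phi2 /GRing.scale/=; field.
Qed.

Let cphi2 l (z : R) : -1 < z < 3 -> {for z, continuous (phi2 l)}.
Proof.
move=> /half_bound hz; apply: contM; first exact: cst_continuous.
apply: (continuous_comp (f := fun z : R => (1 - z) / 2) (g := radial2 c 1 l)).
  exact: is_derive_continuous (dhalf z).
have h := derivableP (@radial2_is_derive _ c 1 l ((1 - z) / 2) c0 hz).
exact: (is_derive_continuous h).
Qed.

Lemma hom0ext_zonal l : hom0ext (zonal l) = fun y => phi l (height y).
Proof.
apply/funext => y; rewrite /hom0ext /zonal /phi /height /rnorm mxE//.
Qed.

Section Cg.
Variable g : R.
Hypothesis g0pi : 0 < g < pi.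

Let cone_dom x : coneg g x -> x != 0 /\ -1 < height x < 3.
Proof.
move=> /coneE[x0 hx]; split => //; have /andP[h1 _] := cos_gtN1 g0pi.
have := height_le1 x; move=> ?; apply/andP; split; lra.
Qed.

Lemma zonal_C2_on l : C2_on (cone g) (hom0ext (zonal l)).
Proof.
rewrite hom0ext_zonal.
apply: (zonal_C2 (@dphi l) (@dphi1 l) (@cphi2 l)).
exact: cone_dom.
Qed.

Lemma zonal_laplace l x : cap g x -> - laplace_beltrami (zonal l) x = l * zonal l x.
Proof.
move=> [cx x1]; have Ax := cone_dom cx.
rewrite /laplace_beltrami hom0ext_zonal.
rewrite (laplacian_zonal (@dphi l) (@dphi1 l) Ax x1).
have [x0 hx] := Ax; have hN : height x = x 0 N by rewrite /height /rnorm x1 invr1 mul1r.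
rewrite hN in hx; have := radial_ode l c0 (half_bound hx).
rewrite /phi1 /phi2 /zonal -/c !mul1r.
set y2 := radial2 _ _ _ _; set y1 := radial1 _ _ _ _; set y := radial _ _ _ _.
have -> : (n%:R : R) = 2 * c by rewrite /c; field.
move: (x 0 N) => z E.
apply/eqP; rewrite -subr_eq0 -oppr_eq0 -[X in _ == X]E; apply/eqP.
by field.
Qed.

Lemma zonal_continuous l : {within closure (cap g), continuous (zonal l)}.
Proof.
apply: continuous_in_subspaceT => x /set_mem /closure_capP[x1 gx].
have /andP[h1 _] := cos_gtN1 g0pi.
have xN : x 0 N <= 1.
  by rewrite -x1; apply: le_trans (ler_norm _) (coord_le_enorm _ _).
apply: (continuous_comp (f := fun y : 'rV[R]_n.+1 => y 0 N) (g := phi l)).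
  exact: coord_continuous.
apply: is_derive_continuous (dphi l _); apply/andP; split; lra.
Qed.

(** The zonal function with parameter l itself vanishes on the boundary, so the
comparison is made with the parameters l' < l, whose zonal functions are positive
on the closed cap. *)
Lemma first_dirichlet_eigenvalue_zonal l :
  first_parameter c ((1 - cos g) / 2) l -> first_dirichlet_eigenvalue n g = l.
Proof.
move=> [l0 yl lpos]; apply: leastE => /=.
  exists (zonal l); split.
  - exact: zonal_C2_on.
  - exact: zonal_continuous.
  - by move=> x /cap_boundary xg; rewrite /zonal xg.
  - by move=> x; exact: zonal_laplace.
  exists (delta_mx 0 N); have e1 : enorm (delta_mx 0 N : 'rV[R]_n.+1) = 1.
    rewrite /enorm (bigD1 N)//= mxE !eqxx expr1n big1 ?addr0 ?sqrtr1// => i iN.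
    by rewrite mxE (negbTE iN) andbF expr0n.
  have /andP[_ h2] := cos_gtN1 g0pi.
  split.
    by split; [split; rewrite -?enorm_gt0 e1// mul1r mxE !eqxx|exact: e1].
  by rewrite /zonal mxE !eqxx subrr mul0r radial_at0 oner_neq0.
move=> mu [u uP]; rewrite leNgt; apply/negP => mul.
(* strictly between mu and l, and nonnegative: mu may be negative *)
pose l' := (Num.max 0 mu + l) / 2.
have m0 : 0 <= Num.max 0 mu by rewrite le_max lexx.
have mm : mu <= Num.max 0 mu by rewrite le_max lexx orbT.
have ml : Num.max 0 mu < l by rewrite gt_max l0.
suff : l' <= mu by rewrite /l'; lra.
apply: (eigenvalue_ge uP (@zonal_C2_on l') (@zonal_continuous l')).
  move=> x /closure_capP[x1 gx].
  have xN : x 0 N <= 1.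
    by rewrite -x1; apply: le_trans (ler_norm _) (coord_le_enorm _ _).
  by apply: lpos; rewrite /l'; apply/andP; split; lra.
exact: zonal_laplace.
Qed.

End Cg.

End Cap.

(** * The limit *)

(** By (1 - cos g) / 2 = sin^2 (g / 2) and the derivative of sin at 0. *)
Lemma versine_cvg (R : realType) :
  ((1 - cos g) / 2 / g ^+ 2 @[g --> (0 : R)^'+] --> (1 / 4 : R)).
Proof.
have h : h^-1 * sin h @[h --> (0 : R)^'] --> (1 : R).
  have d := is_derive_sin (0 : R).
  have := is_derive_derivable d; rewrite /derivable => /cvg_ex[l hl].
  have l1 : l = 1.
    by rewrite -cos0 -(is_derive_val d) /derive; apply/esym/cvg_lim.
  rewrite l1 in hl; apply: cvg_trans hl; apply: near_eq_cvg; near=> h.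
  by rewrite /= addr0 sin0 subr0 [_%:A]mulr1.
have h2 : (g / 2)^-1 * sin (g / 2) @[g --> (0 : R)^'+] --> (1 : R).
  apply: (cvg_comp (G := (0 : R)^') (fun g : R => g / 2) (fun h => h^-1 * sin h)) => //.
  move=> A [e /= e0 he]; exists e => // g /=; rewrite sub0r normrN => ge g0.
  apply: he => /=; last by rewrite gt_eqF// divr_gt0.
  rewrite sub0r normrN gtr0_norm; last by rewrite divr_gt0.
  by rewrite gtr0_norm// in ge; lra.
have -> : (1 / 4 : R) = 1 * 1 / 4 by rewrite mulr1.
have H : ((g / 2)^-1 * sin (g / 2)) * ((g / 2)^-1 * sin (g / 2)) / 4
    @[g --> (0 : R)^'+] --> (1 * 1 / 4 : R).
  by apply: cvgMr_tmp; exact: cvgM.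
apply: cvg_trans H.
apply: near_eq_cvg; near=> g.
have g0 : 0 < g by near: g; exact: nbhs_right_gt.
have -> : cos g = 1 - 2 * sin (g / 2) ^+ 2.
  have -> : cos g = cos ((g / 2) *+ 2) by congr cos; rewrite mulr2n; field.
  by rewrite cos_mulr2n cos2sin2; ring.
by field; rewrite gt_eqF.
Unshelve. all: by end_near. Qed.

Theorem mainTheorem8 (R : realType) (n : nat) (hN : (3 <= n.+1)%N) :
  let lambda1 : R -> R := fun gamma => first_dirichlet_eigenvalue n gamma in
  let B1 : R := first_positive_zero (bessel_J ((n.+1%:R - 3) / 2)) in
  lambda1 gamma * gamma ^+ 2 / B1 ^+ 2 @[gamma --> 0^'+] --> (1 : R).
Proof.
move=> lambda1 B1.
pose c : R := n%:R / 2.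
have c1 : 1 <= c by rewrite /c ler_pdivlMr// mul1r ler_nat.
have c0 : 0 < c by lra.
have [s1 [s10 ys ypos yneg]] := radial_bessel_first_zero c0.
have B1E : B1 ^+ 2 = 4 * s1.
  rewrite /B1 (_ : (n.+1%:R - 3) / 2 = c - 1); last first.
    by rewrite /c -natr1; field.
  rewrite (first_positive_zero_bessel c1 s10 ys ypos).
  by rewrite exprMn sqr_sqrtr ?ltW//; ring.
pose t (g : R) := (1 - cos g) / 2.
have near_itv : \forall g \near (0 : R)^'+, 0 < g < pi.
  near=> g; apply/andP; split; near: g; first exact: nbhs_right_gt.
  by apply: nbhs_right_lt; exact: pi_gt0.
have tpos : \forall g \near (0 : R)^'+, 0 < t g.
  apply: filterS near_itv => g /cos_gtN1 /andP[_ h]; rewrite /t; lra.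
have g2 : g ^+ 2 @[g --> (0 : R)^'+] --> (0 : R).
  rewrite -[X in _ --> X](expr0n R 2).
  by apply: cvg_at_right_filter; exact: (@exprn_continuous R 2 0).
have V := @versine_cvg R.
have t0 : t g @[g --> (0 : R)^'+] --> (0 : R).
  rewrite -[X in _ --> X](mulr0 (1 / 4)).
  have H : (1 - cos g) / 2 / g ^+ 2 * g ^+ 2 @[g --> (0 : R)^'+] --> 1 / 4 * (0 : R).
    exact: cvgM.
  apply: cvg_trans H; apply: near_eq_cvg.
  apply: filterS near_itv => g /andP[g0 _].
  by rewrite /t divfK// expf_neq0// gt_eqF.
have fp : \forall g \near (0 : R)^'+, first_parameter c (t g) (lambda1 g).
  have E : \forall g \near (0 : R)^'+, exists l, first_parameter c (t g) l.
    exact: first_parameter_exists.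
  apply: filterS2 near_itv E => g g0pi [l hl].
  by rewrite /lambda1 (first_dirichlet_eigenvalue_zonal hN g0pi hl).
have L : lambda1 g * t g @[g --> (0 : R)^'+] --> s1.
  exact: first_parameter_cvg fp s10 ypos yneg.
have V' : ((1 - cos g) / 2 / g ^+ 2)^-1 @[g --> (0 : R)^'+] --> ((1 / 4)^-1 : R).
  by apply: cvgV => //; rewrite gt_eqF.
have -> : (1 : R) = s1 * (1 / 4)^-1 / B1 ^+ 2.
  by rewrite B1E; field; rewrite gt_eqF.
have H : lambda1 g * t g * ((1 - cos g) / 2 / g ^+ 2)^-1 / B1 ^+ 2
    @[g --> (0 : R)^'+] --> s1 * (1 / 4)^-1 / B1 ^+ 2.
  by apply: cvgMr_tmp; exact: cvgM.
apply: cvg_trans H.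
apply: near_eq_cvg; apply: filterS2 near_itv tpos => g /andP[g0 _] tg.
congr (_ / _); rewrite -mulrA; congr (_ * _).
by rewrite -/(t g) invfM invrK mulrA mulfV ?mul1r// gt_eqF.
Unshelve. all: by end_near. Qed.
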